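(* Let $H\in(0,1)$, $x_0\in\mathbb R$ and $\alpha\in(0,1)$. Consider the fractional Ornstein--Uhlenbeck process $X$ with unknown drift parameter $\theta\in\mathbb R$, and the test of the hypothesis $H_0\colon\theta\le0$ against the alternative $H_1\colon\theta>0$ at significance level $\alpha$ which, for an observation $X_t$ at a time $t>t_0$, accepts $H_0$ if $g(0,x_0,t,Z(t))\le1-\alpha$ and accepts $H_1$ (rejects $H_0$) otherwise. This test is unbiased, and it is consistent as $t\to\infty$. For the simple alternative $\theta_1>0$ and time $t>t_0$, the power of the test equals $1-g(\theta_1,x_0,t,c_t)$, where $c_t\in(0,1)$ is the solution of $g(0,x_0,t,c_t)=1-\alpha$.
   Context: Let $B^H$ be a fractional Brownian motion with Hurst parameter $H\in(0,1)$ (centered Gaussian, $\mathbf E B^H_tB^H_s=\frac12(|t|^{2H}+|s|^{2H}-|t-s|^{2H})$, continuous modification). The fractional Ornstein--Uhlenbeck process $X$ is the unique solution of $X_t=x_0+\theta\int_0^tX_s\,ds+B^H_t$, $t\ge0$; equivalently $X_t=x_0e^{\theta t}+\theta e^{\theta t}\int_0^te^{-\theta s}B^H_s\,ds+B^H_t$. The test statistic is $Z(t)=\frac{\log^+\log|X_t|}{\log t}$, $t>1$, where $\log^+y=\log y$ if $y>1$ and $\log^+y=0$ otherwise (including $y\le0$ and $y=\log0=-\infty$). For $t\ge1$, $c\ge0$, $\theta\in\mathbb R$, $$g(\theta,x_0,t,c)=\Phi\left(\frac{e^{t^c}-x_0e^{\theta t}}{\sqrt{v(\theta,t)}}\right)+\Phi\left(\frac{e^{t^c}+x_0e^{\theta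 t}}{\sqrt{v(\theta,t)}}\right)-1,\qquad v(\theta,t)=H\int_0^ts^{2H-1}\left(e^{\theta s}+e^{\theta(2t-s)}\right)ds,$$ with $\Phi$ the standard normal distribution function; in particular $v(0,t)=t^{2H}$. The number $t_0\ge1$ is a constant such that for every $t>t_0$ there is a unique $c_t\in(0,1)$ with $g(0,x_0,t,c_t)=1-\alpha$; one may take $t_0$ to be the largest $t\ge1$ satisfying $g(0,x_0,t,0)=1-\alpha$ or $g(0,x_0,t,1)=1-\alpha$. Terminology: writing $\mathbf P_\theta$ for probability when the true drift is $\theta$, the power at $\theta_1$ is $\mathbf P_{\theta_1}(H_0\text{ is rejected})$. Unbiased (at level $\alpha$) means that the rejection probability is at most $\alpha$ for every $\theta$ in $H_0$ and at least $\alpha$ for every $\theta$ in $H_1$. Consistent means that for every fixed $\theta_1$ in $H_1$ the power at $\theta_1$ tends to $1$ as $t\to\infty$. *)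

(* Defs.v *)
From HB Require Import structures.
From mathcomp Require Import all_boot all_order all_algebra.
From mathcomp Require Import all_classical all_reals all_analysis.
Import Order.TTheory GRing.Theory Num.Theory.
Import numFieldNormedType.Exports.

Set Implicit Arguments.
Unset Strict Implicit.
Unset Printing Implicit Defensive.

Local Open Scope classical_set_scope.
Local Open Scope ring_scope.

(* The degenerate case is separate because [normal_prob m 0] is, by convention,
   a uniform law and not the point mass at [m]. *)
Definition gaussian_law (R : realType) (m s : R) (A : set R) : \bar R :=
  if s == 0 then dirac m A else normal_prob m s A.

Definition gaussian_rv d (T : measurableType d) (R : realType)
    (P : probability T R) (Y : T -> R) : Prop :=
  exists m s : R, forall A : set R, measurable A ->
    pushforward P Y A = gaussian_law m s A.

Definition gaussian_process d (T : measurableType d) (R : realType)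
    (P : probability T R) (B : R -> {RV P >-> R}) : Prop :=
  forall (n : nat) (t a : 'I_n -> R), (forall i, 0 <= t i) ->
    gaussian_rv P (fun w => \sum_(i < n) a i * B (t i) w).

(* Processes are indexed by the whole of [R], but only their values at times
   [t >= 0] are ever constrained or used. *)
Definition fBm d (T : measurableType d) (R : realType)
    (P : probability T R) (H : R) (B : R -> {RV P >-> R}) : Prop :=
  [/\ gaussian_process B,
      forall t : R, 0 <= t -> ('E_P[B t] = 0)%E,
      forall t s : R, 0 <= t -> 0 <= s ->
        ('E_P[(fun w => B t w * B s w)%R])%E =
        (2^-1 * (`|t| `^ (2 * H) + `|s| `^ (2 * H) - `|t - s| `^ (2 * H)))%:E
    & {ae P, forall w, {within `[0, +oo[, continuous (fun t : R => B t w)}}].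

Arguments fBm {d T R} P H B.

Definition fOU d (T : measurableType d) (R : realType)
    (P : probability T R) (H x0 theta : R) (X : R -> {mfun T >-> R}) : Prop :=
  exists B : R -> {RV P >-> R}, fBm P H B /\
    {ae P, forall w, forall t : R, 0 <= t ->
      lebesgue_measure.-integrable `[0, t] (EFin \o (fun s : R => X s w)) /\
      X t w = x0 + theta * (\int[lebesgue_measure]_(s in `[0, t]) X s w)
              + B t w}.

(* [ln 0 = 0] here instead of -oo; as [logp] vanishes on both, the convention
   does not affect [Z]. *)
Definition logp (R : realType) (y : R) : R := if 1 < y then ln y else 0.

Definition Z (R : realType) (t x : R) : R := logp (ln `|x|) / ln t.

Definition Phi (R : realType) (x : R) : R :=
  fine (normal_prob 0 1 [set` `]-oo, x]]).

Definition v (R : realType) (H theta t : R) : R :=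
  H * \int[lebesgue_measure]_(s in `[0, t])
        (s `^ (2 * H - 1) * (expR (theta * s) + expR (theta * (2 * t - s)))).

Definition g (R : realType) (H theta x0 t c : R) : R :=
  Phi ((expR (t `^ c) - x0 * expR (theta * t)) / Num.sqrt (v H theta t)) +
  Phi ((expR (t `^ c) + x0 * expR (theta * t)) / Num.sqrt (v H theta t)) - 1.

Definition critical_level (R : realType) (H x0 alpha t c : R) : Prop :=
  0 < c < 1 /\ g H 0 x0 t c = 1 - alpha.

Definition threshold_time (R : realType) (H x0 alpha t0 : R) : Prop :=
  1 <= t0 /\ forall t : R, t0 < t -> exists! c, critical_level H x0 alpha t c.

Definition rejection d (T : measurableType d) (R : realType)
    (H x0 alpha : R) (X : R -> {mfun T >-> R}) (t : R) : set T :=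
  [set w | ~ g H 0 x0 t (Z t (X t w)) <= 1 - alpha].

(* [P] is the statistical model, [P theta] being the law under drift [theta];
   [rej] is the rejection event and [H0], [H1] are sets of drifts. *)
Definition unbiased d (T : measurableType d) (R : realType)
    (P : R -> probability T R) (H0 H1 : set R) (alpha : R) (rej : set T) :=
  (forall theta, H0 theta -> (P theta rej <= alpha%:E)%E) /\
  (forall theta, H1 theta -> (alpha%:E <= P theta rej)%E).

Definition consistent d (T : measurableType d) (R : realType)
    (P : R -> probability T R) (H1 : set R) (rej : R -> set T) :=
  forall theta1, H1 theta1 -> P theta1 (rej t) @[t --> +oo%R] --> 1%E.

(* Main.v *)
(* X solves a linear equation driven by B, so the sums of q ^ (n - i) (B_{s_{i+1}} - B_{s_i})
   over the grid s_i = i t / n, with q = e^(theta t / n), converge almost surely to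
   X_t - x0 e^(theta t): replacing the increments of B by those of X minus theta times
   integrals of X and telescoping leaves an error controlled by the modulus of continuity of X.
   These sums are centered Gaussian, and as the increments of B are stationary, summation by
   parts turns their variance into a Riemann-Stieltjes sum for v(theta, t) against u ^ (2 H).
   Hence X_t has law N(x0 e^(theta t), v(theta, t)).

   As g(0, x0, t, .) is increasing, H_0 is rejected when |X_t| > e^(t^c_t), an event of
   probability 1 - g(theta, x0, t, c_t). Unbiasedness is the monotonicity of g in theta: both
   v(theta, t) and |x0| e^(theta t) / sqrt v(theta, t) are nondecreasing in theta, and
   P(|N + a| <= b) is nonincreasing in |a| and nondecreasing in b. For consistency, e^(t^c_t)
   is O(t^H) whereas sqrt v(theta, t) grows at least like e^(theta t / 2) t^H. *)
Require Import Defs.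
From HB Require Import structures.
From mathcomp Require Import all_boot all_order all_algebra.
From mathcomp Require Import zify ring lra.
From mathcomp Require Import all_classical all_reals all_analysis.
From mathcomp Require Import measurable_realfun.
Import Order.TTheory GRing.Theory Num.Theory.
Import numFieldNormedType.Exports.
Import HBNNSimple.

Local Open Scope classical_set_scope.
Local Open Scope ring_scope.

Set Implicit Arguments.
Unset Strict Implicit.
Unset Printing Implicit Defensive.

(** * The standard normal distribution function *)

(** [gaussian_process] speaks only of finite linear combinations of values of [B], and [X] is known
    only through its integral equation, so Gaussianity of [X t] has to come from a limit of such
    combinations. Three facts about the grids suffice for the limit law: exact distribution
    functions of the sums, variances tending to [v], and almost sure convergence. Continuity of
    [Phi] then takes care of the boundaries of rays.

    Two points shape the variance estimate. When 2H < 1 the weight s^(2H-1) blows up at 0, so it is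
    never sampled at grid points: it is integrated exactly over each cell, to half an increment of
    u^(2H), and only the exponential factor is approximated. And the double sum of covariances is
    avoided by the one-step recurrence of the discounted sum, whose solution becomes a single sum
    once multiplied by [1 + q]. *)

Lemma normal_prob_fin (R : realType) (m s : R) A : measurable A ->
  normal_prob m s A \is a fin_num.
Proof. by move=> mA; exact: fin_num_measure. Qed.

Lemma normal_cdf_derive (R : realType) (m s x : R) : s != 0 ->
  is_derive x 1 (fun y => fine (normal_prob m s `]-oo, y])) (normal_pdf m s x).
Proof.
move=> s0.
have xx1 : x < x + 1 by rewrite ltrDl.
have iN : lebesgue_measure.-integrable [set` `]-oo, x + 1]] (EFin \o normal_pdf m s).
  by apply: integrableS (integrable_normal_pdf m s).
have [dF F'] := continuous_FTC1 xx1 iN (ltNyr x) (@continuous_normal_pdf R m s s0 x).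
apply: DeriveDef; first exact: dF.
rewrite -derive1E; exact: F'.
Qed.

(** The density depends on [s] through its square only. [gaussian_rv] allows a negative scale, which
    is normalised this way. *)
Lemma normal_prob_normr (R : realType) (m s : R) :
  normal_prob m `|s| = normal_prob m s.
Proof.
apply/funext => A; rewrite /normal_prob; apply: eq_integral => x _.
rewrite /normal_pdf normr_eq0; case: ifP => // _.
by rewrite /normal_peak /normal_fun real_normK ?num_real.
Qed.

Lemma normal_cdf_cvgNy (R : realType) (m s : R) :
  fine (normal_prob m s `]-oo, x]) @[x --> -oo%R] --> (0:R).
Proof.
apply/fine_cvg.
(* The identity, taken as a random variable under the normal law, has the wanted function as its
   cdf, so general limits of cdfs apply. *)
pose f : measurableTypeR R -> R := idfun.
have mf : measurable_fun setT f by exact: measurable_id.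
pose F : {RV (normal_prob m s) >-> R} := HB.pack f (isMeasurableFun.Build _ _ _ _ f mf).
exact: (cvg_cdfNy0 F).
Qed.

Lemma normal_cdf_cvgy (R : realType) (m s : R) :
  fine (normal_prob m s `]-oo, x]) @[x --> +oo%R] --> (1:R).
Proof.
apply/fine_cvg.
pose f : measurableTypeR R -> R := idfun.
have mf : measurable_fun setT f by exact: measurable_id.
pose F : {RV (normal_prob m s) >-> R} := HB.pack f (isMeasurableFun.Build _ _ _ _ f mf).
exact: (cvg_cdfy1 F).
Qed.

Lemma Phi_derive (R : realType) (x : R) : is_derive x 1 (@Phi R) (normal_pdf 0 1 x).
Proof. exact: normal_cdf_derive. Qed.

(** No change of variables is made: both sides have the same derivative in [x] and the same limit 0
    at -oo, so their difference is the constant 0. *)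
Lemma normal_cdf_Phi (R : realType) (m s x : R) : 0 < s ->
  normal_prob m s `]-oo, x] = (Phi ((x - m) / s))%:E.
Proof.
move=> s0.
have sn0 : s != 0 by rewrite gt_eqF.
pose F y := fine (normal_prob m s `]-oo, y]) - Phi ((y - m) / s).
have dF (y : R) : is_derive y (1:R) F 0.
  have d1 := normal_cdf_derive m y sn0.
  have d3 : is_derive y 1 (fun y : R => (y - m) / s) s^-1.
    rewrite (_ : (fun _ => _) = s^-1 \*: (id - cst m)); last first.
      by apply/funext => z; rewrite /= mulrC.
    have := is_deriveZ s^-1 (is_deriveB (is_derive_id y (1 : R)) (is_derive_cst m y (1 : R))).
    by rewrite subr0 /GRing.scale/= mulr1.
  have d2 := Phi_derive ((y - m) / s).
  have d4 := @is_derive1_comp R (@Phi R) (fun y : R => (y - m) / s) _ _ _ d2 d3.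
  have := is_deriveB d1 d4.
  rewrite [X in is_derive _ _ _ X -> _](_ : _ = 0)//.
  have E1 : normal_fun m s y = normal_fun 0 1 ((y - m) / s).
    rewrite /normal_fun subr0 expr1n exprMn -mulrnAr exprVn.
    congr expR; rewrite -mulr_natl; field.
    by rewrite sn0.
  have E2 : normal_peak s = normal_peak 1 / s.
    rewrite /normal_peak expr1n mul1r -mulrnAr sqrtrM ?sqr_ge0// sqrtr_sqr.
    by rewrite gtr0_norm// invfM mulrC.
  rewrite !normal_pdfE ?oner_eq0//= E1 E2 /GRing.scale/=.
  apply/eqP; rewrite subr_eq0; apply/eqP; ring.
have Fx : F = cst (F x).
  by apply/funext => y; exact: is_derive_0_is_cst.
have F0 : F y @[y --> -oo] --> (0:R).
  rewrite -[X in _ --> X](subr0 (0:R)); apply: cvgB; first exact: normal_cdf_cvgNy.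
  apply: (@cvg_comp _ _ _ (fun y : R => (y - m) / s) (@Phi R) _ -oo%R).
    by apply/gt0_cvgMlNy; [rewrite invr_gt0|exact: cvg_addrr_Ny].
  exact: normal_cdf_cvgNy.
rewrite Fx in F0.
have : F x = 0 by rewrite -(cvg_lim (@Rhausdorff R) F0) lim_cst.
move=> /eqP; rewrite subr_eq0 => /eqP <-; rewrite fineK//; exact: normal_prob_fin.
Qed.

Lemma Phi_continuous (R : realType) : continuous (@Phi R).
Proof.
by move=> x; apply: differentiable_continuous; apply/derivable1_diffP; case: (Phi_derive x).
Qed.

Lemma normal_pdf01E (R : realType) (x : R) :
  normal_pdf 0 1 x = normal_peak 1 * expR (- x ^+ 2 / 2).
Proof.
rewrite normal_pdfE ?oner_eq0//= /normal_fun subr0 expr1n.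
by congr (_ * expR (_ / _)); rewrite mulr2n.
Qed.

Lemma normal_pdf01_gt0 (R : realType) (x : R) : 0 < normal_pdf 0 1 x.
Proof. by rewrite normal_pdf01E mulr_gt0 ?expR_gt0// normal_peak_gt0// oner_eq0. Qed.

Lemma Phi_lt (R : realType) (x y : R) : x < y -> Phi x < Phi y.
Proof.
move=> xy; apply: (@gtr0_derive1_lt_cc _ _ x y) => //.
- by move=> z _; case: (Phi_derive z).
- by move=> z _; rewrite derive1E; case: (Phi_derive z) => _ ->; exact: normal_pdf01_gt0.
- by apply: continuous_subspaceT; exact: Phi_continuous.
- by rewrite bound_itvE ltW.
- by rewrite bound_itvE ltW.
Qed.

Lemma Phi_le (R : realType) (x y : R) : x <= y -> Phi x <= Phi y.
Proof. by rewrite le_eqVlt => /predU1P[->//|/Phi_lt/ltW]. Qed.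

(** The slope [e] is used at 1 and -1, for the two terms of sums symmetric in [y]. *)
Lemma is_derive_Phi_affine (R : realType) (b e x : R) :
  is_derive x 1 (fun y => Phi (b + e * y)) (e * normal_pdf 0 1 (b + e * x)).
Proof.
have d2 := Phi_derive (b + e * x).
have d1 : is_derive x 1 (fun y : R => b + e * y) e.
  have := is_deriveD (is_derive_cst b x (1 : R)) (is_deriveZ e (is_derive_id x (1 : R))).
  by rewrite add0r /GRing.scale/= mulr1.
by have := @is_derive1_comp R (@Phi R) (fun y : R => b + e * y) _ _ _ d2 d1; rewrite mulrC.
Qed.

(** As the density is even, Phi(y) + Phi(-y) has zero derivative; its limit at +oo is 1. *)
Lemma PhiN (R : realType) (x : R) : Phi (- x) = 1 - Phi x.
Proof.
pose F (y : R) : R := Phi (0 + 1 * y) + Phi (0 + (-1) * y).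
have dF (y : R) : is_derive y (1:R) F 0.
  have := is_deriveD (is_derive_Phi_affine 0 1 y) (is_derive_Phi_affine 0 (-1) y).
  rewrite !add0r !mul1r !mulN1r [X in is_derive _ _ _ X -> _](_ : _ = 0)//.
  by rewrite !normal_pdf01E sqrrN subrr.
have Fx : F = cst (F x).
  by apply/funext => y; exact: is_derive_0_is_cst.
have F0 : F y @[y --> +oo] --> (1:R).
  rewrite -[X in _ --> X](addr0 (1:R)); apply: cvgD.
    under eq_fun do rewrite add0r mul1r.
    exact: normal_cdf_cvgy.
  under eq_fun do rewrite add0r mulN1r.
  apply: (@cvg_comp _ _ _ (fun y : R => - y) (@Phi R) _ -oo%R).
    by apply/cvgNrNy; exact: cvg_id.
  exact: normal_cdf_cvgNy.
rewrite Fx in F0.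
have : F x = 1 by rewrite -(cvg_lim (@Rhausdorff R) F0) lim_cst.
by rewrite /F !add0r mul1r mulN1r => <-; rewrite addrAC subrr add0r.
Qed.

Lemma Phi0 (R : realType) : Phi (0 : R) = 2^-1.
Proof. by have := PhiN (0 : R); rewrite oppr0 => h; lra. Qed.

(** Up to the constant 1 these sums are P(|N + a| <= b). Shrinking [b] is monotonicity of [Phi]. For
    the shift, the sum is even in a, and its derivative pdf(b + a) - pdf(b - a) is nonpositive for
    a, b >= 0, since then |b - a| <= b + a. *)
Lemma Phi_sym_interval_le (R : realType) (a a' b b' : R) :
  `|a| <= `|a'| -> 0 <= b' -> b' <= b ->
  Phi (b' - a') + Phi (b' + a') <= Phi (b - a) + Phi (b + a).
Proof.
move=> aa' b'0 b'b.
apply: (@le_trans _ _ (Phi (b' - a) + Phi (b' + a))); last first.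
  by apply: lerD; apply: Phi_le; lra.
pose F (y : R) : R := Phi (b' + (-1) * y) + Phi (b' + 1 * y).
have FE (y : R) : F y = F `|y|.
  by rewrite /F !mulN1r !mul1r; have [//|_] := ger0P y; rewrite opprK addrC.
suff : F a' <= F a by rewrite /F !mulN1r !mul1r.
rewrite (FE a) (FE a').
have dF (y : R) : is_derive y (1:R) F (normal_pdf 0 1 (b' + y) - normal_pdf 0 1 (b' - y)).
  have := is_deriveD (is_derive_Phi_affine b' (-1) y) (is_derive_Phi_affine b' 1 y).
  by rewrite !mul1r !mulN1r [X in is_derive _ _ _ X -> _]addrC.
apply: (@ler0_derive1_le_cc _ _ 0 `|a'|) => //.
- move=> z; rewrite in_itv/= => /andP[z0 _]; rewrite derive1E; case: (dF z) => _ ->.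
  rewrite subr_le0 !normal_pdf01E ler_wpM2l ?normal_peak_ge0// ler_expR.
  rewrite ler_wpM2r ?invr_ge0// lerN2 !expr2.
  nra.
- apply: continuous_subspaceT => z; apply: differentiable_continuous.
  by apply/derivable1_diffP; case: (dF z).
- by rewrite bound_itvE normr_ge0.
- by rewrite in_itv/= normr_ge0.
Qed.

Lemma Phi_cvgy (R : realType) : Phi x @[x --> +oo%R] --> (1 : R).
Proof. exact: normal_cdf_cvgy. Qed.

(** * Integration against normal laws, and their first two moments *)

(** The law of a set is by definition the integral of the density over it, which settles indicators;
    simple approximations and monotone convergence do the rest. *)
Lemma ge0_integral_normal (R : realType) (m s : R) (f : measurableTypeR R -> \bar R) :
  measurable_fun [set: measurableTypeR R] f -> (forall x, 0 <= f x)%E ->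
  (\int[normal_prob m s]_x f x =
   \int[lebesgue_measure]_x (f x * (normal_pdf m s x)%:E))%E.
Proof.
move=> mf f0; set mu := lebesgue_measure.
have mp : measurable_fun [set: measurableTypeR R] (EFin \o normal_pdf m s).
  by apply/measurable_EFinP; exact: measurable_normal_pdf.
have p0 x : (0 <= (normal_pdf m s x)%:E)%E by rewrite lee_fin normal_pdf_ge0.
pose f_ := nnsfun_approx measurableT mf.
have f_cvg x : (f_ n x)%:E @[n --> \oo] --> f x by exact: cvg_nnsfun_approx.
transitivity (limn (fun n => \int[normal_prob m s]_x (f_ n x)%:E)%E).
  rewrite -monotone_convergence//.
  - by apply: eq_integral => y _; apply/esym/cvg_lim => //; exact: f_cvg.
  - move=> n; apply/measurable_EFinP. exact: measurable_funPT.
  - by move=> n y _; rewrite lee_fin.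
  - by move=> y _ k n kn; rewrite lee_fin; exact/lefP/nd_nnsfun_approx.
transitivity (limn (fun n => \int[mu]_x ((f_ n x)%:E * (normal_pdf m s x)%:E))%E); last first.
  rewrite -monotone_convergence//.
  - apply: eq_integral => y _; apply/cvg_lim => //.
    by apply: cvgeZr => //; exact: f_cvg.
  - move=> n; apply: emeasurable_funM => //.
    exact/measurable_EFinP/measurable_funP.
  - by move=> n y _; rewrite mule_ge0// lee_fin.
  - move=> y _ k n kn; rewrite lee_wpmul2r//.
    by rewrite lee_fin; exact/lefP/nd_nnsfun_approx.
congr (limn _); apply/funext => n.
under eq_integral do rewrite fimfunE -fsumEFin//.
rewrite ge0_integral_fsum//; last 2 first.
- by move=> r; exact/measurable_EFinP/measurable_funM.
- by move=> r x _; rewrite nnfun_muleindic_ge0.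
under [RHS]eq_integral => x _.
  rewrite fimfunE -fsumEFin// ge0_mule_fsuml; last by move=> r; rewrite nnfun_muleindic_ge0.
  over.
rewrite ge0_integral_fsum//; last 2 first.
- move=> r; apply: emeasurable_funM => //.
  exact/measurable_EFinP/measurable_funM.
- by move=> r x _; rewrite mule_ge0// nnfun_muleindic_ge0.
apply: eq_fsbigr => r _.
rewrite integralZl_indic_nnsfun// integral_indic// setIT.
transitivity (r%:E * \int[mu]_(x in f_ n @^-1` [set r]) (normal_pdf m s x)%:E)%E; first by [].
rewrite -integralZl//; last first.
  by apply: integrableS (integrable_normal_pdf m s).
rewrite [LHS]integral_mkcond; apply: eq_integral => x _.
rewrite patchE indicE; case: (x \in _); first by rewrite mulr1.
by rewrite mulr0 mul0e.
Qed.

Lemma is_derive_normal_pdf01 (R : realType) (x : R) :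
  is_derive x 1 (@normal_pdf R 0 1) (- x * normal_pdf 0 1 x).
Proof.
have -> : @normal_pdf R 0 1 = normal_peak 1 \*: (@expR R \o (- 2^-1 \*: (fun y : R => y ^+ 2))).
  apply/funext => y; rewrite normal_pdf01E/=; congr (_ * expR _).
  by rewrite /GRing.scale/= mulNr mulrC mulNr.
have d1 : is_derive x 1 (- 2^-1 \*: (fun y : R => y ^+ 2)) (- x).
  have := is_deriveZ (- 2^-1) (is_deriveX 2 (is_derive_id x (1 : R))).
  rewrite [X in is_derive _ _ _ X -> _](_ : _ = - x)//.
  rewrite /GRing.scale/= expr1 mulr1 -mulr_natl mulrA.
  by rewrite mulNr mulVf ?pnatr_eq0// mulN1r.
have := is_deriveZ (normal_peak 1)
  (@is_derive1_comp R (@expR R) (- 2^-1 \*: (fun y : R => y ^+ 2)) x _ _ (is_derive_expR _) d1).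
rewrite [X in is_derive _ _ _ X -> _](_ : _ = - x * (normal_peak 1 * expR (- 2^-1 * x ^+ 2)))//.
by rewrite /GRing.scale/=; ring.
Qed.

(** Since e^(x^2/2) >= 1 + x^2/2, the quantity lies below [2 * normal_peak 1 / x]. *)
Lemma cvg_x_normal_pdf01 (R : realType) : x * normal_pdf 0 1 x @[x --> +oo%R] --> (0 : R).
Proof.
have h : 2 * normal_peak 1 / x @[x --> +oo%R] --> (0 : R).
  rewrite -(mulr0 (2 * normal_peak 1)); apply: cvgM; first exact: cvg_cst.
  by apply/gtr0_cvgV0; [exact: nbhs_pinfty_gt|exact: cvg_id].
apply: (squeeze_cvgr _ (cvg_cst 0) h).
near=> x.
have x0 : 0 < x by near: x; exact: nbhs_pinfty_gt.
rewrite mulr_ge0 ?normal_pdf_ge0 ?ltW//=.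
rewrite normal_pdf01E mulrCA [ltRHS](_ : _ = normal_peak 1 * (2 / x)); last by ring.
rewrite ltr_pM2l ?normal_peak_gt0 ?oner_eq0//.
rewrite ltr_pdivlMr// mulrAC -expr2 mulNr expRN ltr_pdivrMr ?expR_gt0//.
have := expR_ge1Dx (x ^+ 2 / 2).
lra.
Unshelve. all: by end_near. Qed.

Lemma integral_sqr_normal01 (R : realType) :
  (\int[lebesgue_measure]_x (x ^+ 2 * normal_pdf 0 1 x)%:E = (1%R : R)%:E)%E.
Proof.
have cf : continuous (fun x : R => x ^+ 2 * normal_pdf 0 1 x).
  move=> x; apply: cvgM; first exact: sqr_continuous.
  by apply: continuous_normal_pdf; rewrite oner_eq0.
rewrite ge0_symfun_integralT//; last 2 first.
- by move=> x; rewrite mulr_ge0 ?sqr_ge0 ?normal_pdf_ge0.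
- by move=> x /=; rewrite !normal_pdf01E !sqrrN.
(* Integration by parts: the density has derivative -x times itself, so [G] is a primitive of the
   integrand. It rises from 1/2 at 0 to 1 at +oo, and evenness doubles the gain. *)
pose G (x : R) := Phi x - x * normal_pdf 0 1 x.
have dG (x : R) : is_derive x 1 G (x ^+ 2 * normal_pdf 0 1 x).
  have := is_deriveB (Phi_derive x) (is_deriveM (is_derive_id x (1 : R)) (is_derive_normal_pdf01 x)).
  rewrite [X in is_derive _ _ _ X -> _](_ : _ = x ^+ 2 * normal_pdf 0 1 x)//.
  rewrite /GRing.scale/=; ring.
rewrite -set_itvcy (@ge0_continuous_FTC2y _ _ G 0 1).
- rewrite /G mul0r Phi0 subr0 -EFinB -EFinM; congr EFin; lra.
- by move=> x _; rewrite mulr_ge0 ?sqr_ge0 ?normal_pdf_ge0.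
- exact: continuous_subspaceT.
- rewrite -[X in _ --> X]subr0; apply: cvgB; first exact: Phi_cvgy.
  exact: cvg_x_normal_pdf01.
- by move=> x _; case: (dG x).
- apply/cvg_at_right_filter; apply: differentiable_continuous.
  by apply/derivable1_diffP; case: (dG 0).
- by move=> x _; rewrite derive1E; case: (dG x).
Qed.

Lemma probability_unique_rays (R : realType) (P Q : probability (measurableTypeR R) R) :
  (forall x : R, P `]-oo, x]%classic = Q `]-oo, x]%classic) -> forall A, measurable A -> P A = Q A.
Proof.
move=> PQ.
pose g (n : nat) : set (measurableTypeR R) := `](- n%:R : R), +oo[%classic.
have IG : setI_closed (@RGenOInfty.G R).
  move=> _ _ [x ->] [y ->]; exists (Num.max x y); apply/seteqP; split => z /=.
    by rewrite !in_itv/= !andbT gt_max => -[-> ->].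
  by rewrite !in_itv/= !andbT gt_max => /andP[].
have Gg i : (@RGenOInfty.G R) (g i) by exists (- i%:R).
have gT : \bigcup_i g i = setT.
  apply/seteqP; split => // x _; exists (Num.bound `|x : R|) => //.
  rewrite /g/= in_itv/= andbT ltrNl.
  by rewrite (le_lt_trans _ (archi_boundP (normr_ge0 _)))// -normrN ler_norm.
apply: (@measure_unique _ R (measurableTypeR R) _ g (RGenOInfty.measurableE R) IG Gg gT P Q).
- move=> _ [x ->]; rewrite -setCitvl.
  by rewrite [LHS]probability_setC// [RHS]probability_setC// PQ.
- by move=> k; rewrite -ge0_fin_numE// fin_num_measure//; exact: measurable_itv.
Qed.

Lemma integrable_mul_of_sqr d (T : measurableType d) (R : realType) (P : {measure set T -> \bar R})
    (f g : T -> R) :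
  measurable_fun setT f -> measurable_fun setT g ->
  P.-integrable setT (EFin \o (fun x => f x ^+ 2)) ->
  P.-integrable setT (EFin \o (fun x => g x ^+ 2)) ->
  P.-integrable setT (EFin \o (fun x => f x * g x)).
Proof.
move=> mf mg if2 ig2; have ifg := integrableD measurableT if2 ig2.
apply: le_integrable ifg => //.
  by apply/measurable_EFinP; exact: measurable_funM.
move=> x _ /=; rewrite lee_fin normrM.
rewrite [leRHS]ger0_norm ?addr_ge0 ?sqr_ge0//.
rewrite -(real_normK (num_real (f x))) -(real_normK (num_real (g x))).
have := sqr_ge0 (`|f x| - `|g x|); have := normr_ge0 (f x); have := normr_ge0 (g x).
nra.
Qed.

Lemma normal01_integral_sqr (R : realType) :
  (\int[normal_prob 0 1]_x ((x : R) ^+ 2)%:E = 1)%E.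
Proof.
rewrite ge0_integral_normal//; first exact: integral_sqr_normal01.
  by apply/measurable_EFinP; exact: measurable_funX.
by move=> x; rewrite lee_fin sqr_ge0.
Qed.

Lemma normal01_integrable_sqr (R : realType) :
  (normal_prob (0 : R) 1).-integrable setT (fun x => (x ^+ 2)%:E).
Proof.
apply/integrableP; split.
  by apply/measurable_EFinP; exact: measurable_funX.
under eq_integral do rewrite gee0_abs ?lee_fin ?sqr_ge0//.
by rewrite normal01_integral_sqr ltry.
Qed.

Lemma normal01_integrable (R : realType) :
  (normal_prob (0 : R) 1).-integrable setT (fun x => x%:E).
Proof.
have i1 : (normal_prob (0 : R) 1).-integrable setT (EFin \o (fun _ : R => 1 ^+ 2)).
  by apply: finite_measure_integrable_cst.
have mid : measurable_fun [set: measurableTypeR R] (fun x : measurableTypeR R => x : R).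
  exact: measurable_id.
have := integrable_mul_of_sqr mid (@measurable_cst _ _ _ _ _ (1 : R)) (normal01_integrable_sqr R) i1.
by congr (_.-integrable _ _); apply/funext => x /=; rewrite mulr1.
Qed.

Lemma normal01_opp (R : realType) (A : set (measurableTypeR R)) : measurable A ->
  normal_prob (0 : R) 1 A = normal_prob 0 1 (-%R @^-1` A).
Proof.
move=> mA; pose F : measurableTypeR R -> measurableTypeR R := -%R.
have mF : measurable_fun setT F by exact: (@oppr_measurable R).
pose X : {mfun measurableTypeR R >-> measurableTypeR R} :=
  HB.pack F (isMeasurableFun.Build _ _ _ _ F mF).
apply: (@probability_unique_rays R (normal_prob 0 1) (distribution (normal_prob 0 1) X)) => // x.
rewrite /distribution /pushforward/=.
have -> : F @^-1` `]-oo, x]%classic = `[- x, +oo[%classic.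
  by apply/seteqP; split => z; rewrite /F/= !in_itv/= andbT lerNl.
rewrite -setCitvl [RHS]probability_setC//.
transitivity (1 - normal_prob 0 1 `]-oo, (- x)%R]%classic)%E; last first.
  congr (_ - _)%E; rewrite -[RHS]/(normal_prob 0 1 _) /normal_prob -integral_itv_bndo_bndc//.
  by apply/measurable_funTS/measurable_EFinP; exact: measurable_normal_pdf.
have := PhiN x; rewrite /Phi => h.
rewrite -[X in _ = (_ - X)%E](@fineK R) ?normal_prob_fin// h -EFinB subKr fineK//.
exact: normal_prob_fin.
Qed.

(** The law is invariant under negation, so the mean equals its opposite; integrability makes it
    finite, hence zero. *)
Lemma normal01_integral (R : realType) :
  (\int[normal_prob 0 1]_x (x : R)%:E = 0)%E.
Proof.
set I := LHS.
have fI : I \is a fin_num by apply: integrable_fin_num => //; exact: normal01_integrable.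
pose F : measurableTypeR R -> measurableTypeR R := -%R.
have mF : measurable_fun setT F by exact: (@oppr_measurable R).
pose X : {mfun measurableTypeR R >-> measurableTypeR R} :=
  HB.pack F (isMeasurableFun.Build _ _ _ _ F mF).
have : I = (- I)%E.
  rewrite {1}/I (@eq_measure_integral _ _ _ _ (distribution (normal_prob 0 1) X)); last first.
    by move=> A mA _; exact: normal01_opp.
  rewrite integral_distribution//.
    transitivity (\int[normal_prob 0 1]_x ((-1)%:E * (x : R)%:E))%E.
      by apply: eq_integral => x _; rewrite -EFinM mulN1r.
    by rewrite integralZl//; [rewrite mulN1e|exact: normal01_integrable].
  have := integrableZl measurableT (-1) (normal01_integrable R).
  by congr (_.-integrable _ _); apply/funext => x /=; rewrite -EFinM mulN1r.
move: fI; rewrite /I; case: (\int[_]_x _)%E => //= r _ [] rr.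
by congr EFin; lra.
Qed.

(** Seeing every Gaussian law, the point mass included, as an affine image of N(0, 1) gives the
    moments of both cases at once. *)
Lemma gaussian_law_pushforward (R : realType) (m s : R) (A : set (measurableTypeR R)) :
  measurable A ->
  gaussian_law m s A = normal_prob 0 1 ((fun x : R => m + `|s| * x) @^-1` A).
Proof.
move=> mA; rewrite /gaussian_law; have [->|s0] := eqVneq s 0.
  rewrite diracE; under eq_fun do rewrite normr0 mul0r addr0.
  case: (boolP (m \in A)) => mAm.
    rewrite (_ : _ @^-1` A = setT); first by rewrite [RHS]probability_setT.
    by apply/seteqP; split => // x _; rewrite inE in mAm.
  rewrite (_ : _ @^-1` A = set0); first by rewrite [RHS]measure0.
  by apply/seteqP; split => // x /=; rewrite notin_setE in mAm.
have s1 : 0 < `|s| by rewrite normr_gt0.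
pose F : measurableTypeR R -> measurableTypeR R := fun x => m + `|s| * x.
have mF : measurable_fun setT F.
  by apply: measurable_funD => //; exact: measurable_funM.
pose X : {mfun measurableTypeR R >-> measurableTypeR R} :=
  HB.pack F (isMeasurableFun.Build _ _ _ _ F mF).
have E (x : R) : normal_prob m s `]-oo, x]%classic = distribution (normal_prob 0 1) X `]-oo, x]%classic.
  rewrite -[RHS]/(normal_prob 0 1 (F @^-1` `]-oo, x]%classic)).
  have -> : F @^-1` `]-oo, x]%classic = `]-oo, ((x - m) / `|s|)]%classic.
    by apply/seteqP; split => z; rewrite /F/= !in_itv/= ler_pdivlMr// lerBrDl mulrC.
  by rewrite -normal_prob_normr normal_cdf_Phi// /Phi fineK// normal_prob_fin.
rewrite -[RHS]/(distribution (normal_prob 0 1) X A).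
exact: (probability_unique_rays E mA).
Qed.

Lemma integral_same_law d d' (T : measurableType d) (T' : measurableType d') (R : realType)
    (P : probability T R) (P' : probability T' R)
    (Y : {mfun T >-> measurableTypeR R}) (Y' : {mfun T' >-> measurableTypeR R})
    (h : measurableTypeR R -> \bar R) :
  (forall A, measurable A -> P (Y @^-1` A) = P' (Y' @^-1` A)) ->
  measurable_fun setT h ->
  P.-integrable setT (h \o Y) -> P'.-integrable setT (h \o Y') ->
  (\int[P]_x h (Y x) = \int[P']_x h (Y' x))%E.
Proof.
move=> YY' mh iY iY'; rewrite -[LHS]integral_distribution// -[RHS]integral_distribution//.
by apply: eq_measure_integral => A mA _; exact: YY'.
Qed.

Lemma normal01_affine_integrable (R : realType) (m s : R) :
  (normal_prob 0 1).-integrable setT (fun x : R => (m + s * x)%:E).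
Proof.
have i1 : (normal_prob (0 : R) 1).-integrable setT (EFin \o cst m).
  exact: finite_measure_integrable_cst.
have := integrableD measurableT i1 (integrableZl measurableT s (normal01_integrable R)).
exact.
Qed.

Lemma normal01_affine_integral (R : realType) (m s : R) :
  (\int[normal_prob 0 1]_x (m + s * x)%:E = m%:E)%E.
Proof.
under eq_integral do rewrite EFinD EFinM.
rewrite integralD//; last 2 first.
- exact: finite_measure_integrable_cst.
- exact: integrableZl (normal01_integrable R).
rewrite integralZl//; last exact: normal01_integrable.
rewrite normal01_integral mule0 adde0 integral_cst//.
by rewrite [X in (_ * X)%E](@probability_setT _ _ _ (normal_prob 0 1)) mule1.
Qed.

Lemma normal01_affine_integrable_sqr (R : realType) (m s : R) :
  (normal_prob 0 1).-integrable setT (fun x : R => ((m + s * x) ^+ 2)%:E).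
Proof.
have i1 := normal01_affine_integrable (m ^+ 2) (2 * m * s).
have i2 := integrableZl measurableT (s ^+ 2) (normal01_integrable_sqr R).
have := integrableD measurableT i1 i2.
by congr (_.-integrable _ _); apply/funext => x /=; rewrite -EFinM -EFinD; congr EFin; ring.
Qed.

Lemma normal01_affine_integral_sqr (R : realType) (m s : R) :
  (\int[normal_prob 0 1]_x ((m + s * x) ^+ 2)%:E = (m ^+ 2 + s ^+ 2)%:E)%E.
Proof.
have i1 := normal01_affine_integrable (m ^+ 2) (2 * m * s).
have i2 := integrableZl measurableT (s ^+ 2) (normal01_integrable_sqr R).
transitivity (\int[normal_prob 0 1]_x
    ((m ^+ 2 + (2 * m * s) * x)%:E + (s ^+ 2)%:E * ((x : R) ^+ 2)%:E))%E.
  by apply: eq_integral => x _; rewrite -EFinM -EFinD; congr EFin; ring.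
rewrite integralD// normal01_affine_integral integralZl//; last exact: normal01_integrable_sqr.
by rewrite normal01_integral_sqr mule1.
Qed.

(** [gaussian_rv] only asserts that some [m] and [s] exist. Comparing the first two moments with
    those of m + |s| N forces m = 0 and s^2 = V, and V > 0 excludes the point mass. *)
Lemma gaussian_rv_cdf d (T : measurableType d) (R : realType) (P : probability T R)
    (Y : {mfun T >-> R}) (V : R) :
  0 < V -> gaussian_rv P Y ->
  P.-integrable setT (EFin \o Y) -> P.-integrable setT (EFin \o (fun w => Y w ^+ 2)) ->
  (\int[P]_w (Y w)%:E = 0)%E -> (\int[P]_w (Y w ^+ 2)%:E = V%:E)%E ->
  forall y : R, P [set w | Y w <= y] = (Phi (y / Num.sqrt V))%:E.
Proof.
move=> V0 [m [s gY]] iY iY2 EY EY2 y.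
pose F : measurableTypeR R -> measurableTypeR R := fun x => m + `|s| * x.
have mF : measurable_fun setT F.
  by apply: measurable_funD => //; exact: measurable_funM.
pose X : {mfun measurableTypeR R >-> measurableTypeR R} :=
  HB.pack F (isMeasurableFun.Build _ _ _ _ F mF).
have YX (A : set (measurableTypeR R)) : measurable A -> P (Y @^-1` A) = normal_prob 0 1 (X @^-1` A).
  by move=> mA; rewrite -gaussian_law_pushforward// -gY.
pose G : T -> measurableTypeR R := Y.
have mG : measurable_fun setT G by exact: (measurable_funPT Y).
pose YR : {mfun T >-> measurableTypeR R} := HB.pack G (isMeasurableFun.Build _ _ _ _ G mG).
have m0 : m = 0.
  have := @integral_same_law _ _ _ _ R P (normal_prob 0 1) YR X EFin YX.
  rewrite EY normal01_affine_integral => h; apply/esym/EFin_inj; apply: h => //.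
  exact: normal01_affine_integrable.
have s2 : s ^+ 2 = V.
  have := @integral_same_law _ _ _ _ R P (normal_prob 0 1) YR X (fun x => (x ^+ 2)%:E) YX.
  rewrite EY2 normal01_affine_integral_sqr real_normK ?num_real// m0 expr0n/= add0r => h.
  apply/esym/EFin_inj; apply: h => //.
    by apply/measurable_EFinP; exact: measurable_funX.
  exact: normal01_affine_integrable_sqr.
have s0 : s != 0 by rewrite -sqrf_eq0 s2 gt_eqF.
have := gY `]-oo, y]%classic (measurable_itv _).
rewrite /gaussian_law (negbTE s0) -normal_prob_normr normal_cdf_Phi ?normr_gt0//.
by rewrite m0 subr0 -s2 sqrtr_sqr => <-.
Qed.

(** * Variance of discounted sums of stationary increments *)

(** [V n] stands for the variance of an n-term discounted sum and [dl] for the first differences of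
    the variance function of the driving process, whose second differences are twice the covariances
    of its increments. The result involves first differences only, ready for a Riemann-Stieltjes
    sum. *)
Lemma stationary_increments_sum (R : comRingType) (q : R) (dl : nat -> R) (V : nat -> R) :
  V 0%N = 0 ->
  (forall n, V n.+1 = q ^+ 2 * (V n + \sum_(j < n) q ^+ j.+1 * (dl j.+1 - dl j) + dl 0%N)) ->
  forall n, (1 + q) * V n = \sum_(k < n) dl k * (q ^+ ((2 * n).+1 - k) + q ^+ k.+2).
Proof.
move=> V0 VS.
(* Summation by parts moves the differences from [dl] onto the powers of [q]. *)
have AE n : \sum_(j < n) q ^+ j.+1 * (dl j.+1 - dl j) + dl 0%N =
    q ^+ n * dl n + \sum_(k < n) dl k * (q ^+ k - q ^+ k.+1).
  elim: n => [|n IH]; first by rewrite !big_ord0 expr0 mul1r addr0 add0r.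
  rewrite !big_ord_recr/= addrAC IH !exprS; ring.
elim=> [|n IH]; first by rewrite big_ord0 V0 mulr0.
rewrite VS -addrA AE.
set B := \sum_(k < n) _.
(* Since (1 + q)(1 - q) = 1 - q^2, the term of index k in [B] contributes q^(k+2) - q^(k+4), which
   restores the exponent that [q ^+ 2] has raised in the induction hypothesis. *)
transitivity (q ^+ 2 * ((1 + q) * V n) + q ^+ 2 * (1 + q) * B +
  q ^+ 2 * (1 + q) * (q ^+ n * dl n)); first by ring.
rewrite IH /B big_ord_recr/= (_ : (2 * n.+1).+1 - n = n.+3)%N; last by lia.
rewrite !mulr_sumr -big_split/=; congr (_ + _).
  apply: eq_bigr => k _.
  rewrite (_ : (2 * n.+1).+1 - k = ((2 * n).+1 - k).+2)%N; last by case: k => /= k; lia.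
  by rewrite !exprS; ring.
by rewrite !exprS; ring.
Qed.

(** * Square-integrable functions and the second moment of a discounted sum *)

Section square_integrable.
Context d (T : measurableType d) (R : realType) (P : probability T R).

Definition sqint (f : T -> R) :=
  measurable_fun setT f /\ P.-integrable setT (EFin \o (fun w => f w ^+ 2)).

Definition inner (f g : T -> R) : R := \int[P]_w (f w * g w).

Lemma sqint_mul f g : sqint f -> sqint g ->
  P.-integrable setT (EFin \o (fun w => f w * g w)).
Proof. by move=> [mf if2] [mg ig2]; exact: integrable_mul_of_sqr. Qed.

Lemma sqint_integrable f : sqint f -> P.-integrable setT (EFin \o f).
Proof.
move=> sf; have s1 : sqint (cst 1).
  split; first exact: measurable_cst.
  by have := finite_measure_integrable_cst P (1 ^+ 2 : R); apply.
have := sqint_mul sf s1.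
by congr (_.-integrable _ _); apply/funext => w /=; rewrite mulr1.
Qed.

Lemma sqintZ a f : sqint f -> sqint (fun w => a * f w).
Proof.
move=> [mf if2]; split; first exact: measurable_funM.
have := integrableZl measurableT (a ^+ 2) if2.
by congr (_.-integrable _ _); apply/funext => w /=; rewrite -EFinM exprMn.
Qed.

Lemma sqintD f g : sqint f -> sqint g -> sqint (fun w => f w + g w).
Proof.
move=> sf sg; split; first by apply: measurable_funD; [case: sf|case: sg].
have i1 := integrableD measurableT sf.2 sg.2.
have := integrableD measurableT i1 (sqint_mul (sqintZ 2 sf) sg).
congr (_.-integrable _ _); apply/funext => w /=; rewrite -!EFinD; congr EFin; ring.
Qed.

Lemma sqint0 : sqint (cst 0).
Proof.
split; first exact: measurable_cst.
by have := finite_measure_integrable_cst P (0 ^+ 2 : R); apply.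
Qed.

Lemma inner_sym f g : inner f g = inner g f.
Proof. by apply: eq_Rintegral => w _; rewrite mulrC. Qed.

Lemma innerDl f g h : sqint f -> sqint g -> sqint h ->
  inner (fun w => f w + g w) h = inner f h + inner g h.
Proof.
move=> sf sg sh; rewrite /inner -RintegralD//; [|exact: sqint_mul..].
by apply: eq_Rintegral => w _; rewrite mulrDl.
Qed.

Lemma innerZl a f h : sqint f -> sqint h ->
  inner (fun w => a * f w) h = a * inner f h.
Proof.
move=> sf sh; rewrite /inner -RintegralZl//; last exact: sqint_mul.
by apply: eq_Rintegral => w _; rewrite mulrA.
Qed.

(** The recursive form makes the one-step recurrence definitional, both for the variance and for the
    pathwise error. *)
Fixpoint discount_sum (q : R) (D : nat -> T -> R) (n : nat) (w : T) : R :=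
  if n is m.+1 then q * (discount_sum q D m w + D m w) else 0.

Lemma discount_sumE q D n w :
  discount_sum q D n w = \sum_(i < n) q ^+ (n - i) * D i w.
Proof.
elim: n => [|n IH]; first by rewrite big_ord0.
rewrite big_ord_recr/= subSnn expr1 mulrDr IH mulr_sumr; congr (_ + _).
by apply: eq_bigr => i _; rewrite mulrA -exprS subSn// ltnW.
Qed.

Lemma sqint_discount_sum q D n : (forall i, sqint (D i)) -> sqint (discount_sum q D n).
Proof.
by move=> sD; elim: n => [|n IH]; [exact: sqint0|exact: sqintZ (sqintD IH (sD n))].
Qed.

Lemma inner_discount_sum_l q D n h : (forall i, sqint (D i)) -> sqint h ->
  inner (discount_sum q D n) h = \sum_(i < n) q ^+ (n - i) * inner (D i) h.
Proof.
move=> sD sh; elim: n => [|n IH].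
  rewrite big_ord0 /inner.
  by under eq_Rintegral do rewrite mul0r; rewrite Rintegral_cst// mul0r.
have sW := sqint_discount_sum q n sD.
rewrite [LHS]innerZl//; last exact: sqintD.
rewrite innerDl// IH big_ord_recr/= subSnn expr1 mulrDr mulr_sumr; congr (_ + _).
by apply: eq_bigr => i _; rewrite mulrA -exprS subSn// ltnW.
Qed.

(** The two hypotheses on [inner] express stationarity: [dl 0] is the variance of an increment, and
    half a difference of [dl] is the covariance at lag [k.+1]. Expanding the square at step n yields
    twice the covariances with [D n], which cancels that half. *)
Lemma inner_discount_sum q D (dl : nat -> R) : (forall i, sqint (D i)) ->
  (forall i, inner (D i) (D i) = dl 0%N) ->
  (forall i k, inner (D i) (D (i + k.+1)%N) = (dl k.+1 - dl k) / 2) ->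
  forall n, (1 + q) * inner (discount_sum q D n) (discount_sum q D n) =
    \sum_(k < n) dl k * (q ^+ ((2 * n).+1 - k) + q ^+ k.+2).
Proof.
move=> sD D0 DS; apply: stationary_increments_sum => [|n].
  rewrite /inner.
  by under eq_Rintegral do rewrite /= mul0r; rewrite Rintegral_cst// mul0r.
have sW := sqint_discount_sum q n sD.
have sWD := sqintD sW (sD n).
rewrite [LHS]innerZl//; last exact: sqintZ.
rewrite inner_sym innerZl// innerDl// [X in _ * (_ * (X + _))]inner_sym innerDl//.
rewrite [X in _ * (_ * (_ + X))]inner_sym innerDl// D0 [inner (D n) _]inner_sym.
rewrite (inner_discount_sum_l q n sD (sD n)).
rewrite (_ : \sum_(i < n) q ^+ (n - i) * inner (D i) (D n) =
  2^-1 * \sum_(j < n) q ^+ j.+1 * (dl j.+1 - dl j)); first by field.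
(* Reversing the index makes the summation variable the lag to [D n], minus one. *)
rewrite (reindex_inj rev_ord_inj)/= mulr_sumr; apply: eq_bigr => i _.
have lin : (i < n)%N by [].
rewrite (_ : n - (n - i.+1) = i.+1)%N; last by lia.
have := DS (n - i.+1)%N i; rewrite subnK// => ->; ring.
Qed.

End square_integrable.

(** * The variance function of the fractional Ornstein-Uhlenbeck process *)

Section powR_integral.
Context (R : realType).
Local Notation mu := (@lebesgue_measure R).

Lemma measurable_powR_fun (D : set R) (p : R) : measurable_fun D (fun s : R => s `^ p).
Proof. by apply: (measurable_funS measurableT) => //; exact: measurable_powR. Qed.

Lemma integral_powR_pos (p a b : R) : 0 < a -> a < b ->
  (\int[mu]_(s in `[a, b]) (p * s `^ (p - 1))%:E = (b `^ p)%:E - (a `^ p)%:E)%E.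
Proof.
move=> a0 ab.
have pos x : x \in `[a, b] -> 0 < x by rewrite in_itv/= => /andP[ax _]; exact: lt_le_trans ax.
have cont q x : 0 < x -> {for x, continuous (fun s : R => s `^ q)}.
  move=> x0; apply: differentiable_continuous; apply/derivable1_diffP.
  by case: (is_derive1_powR q x0).
apply: (@continuous_FTC2 _ _ (fun s : R => s `^ p)) => //.
- apply: continuous_in_subspaceT => x /[!inE] /pos x0.
  by apply: cvgM; [exact: cvg_cst|exact: cont].
- split.
  + move=> x xab; have x0 : 0 < x by apply: pos; exact: subset_itv_oo_cc xab.
    by case: (is_derive1_powR p x0).
  + by apply: cvg_at_right_filter; exact: cont.
  + by apply: cvg_at_left_filter; apply: cont; exact: lt_trans ab.
- move=> x xab; have x0 : 0 < x by apply: pos; exact: subset_itv_oo_cc xab.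
  by rewrite derive1E; case: (is_derive1_powR p x0).
Qed.

(** For p < 1 the integrand is unbounded at 0, so the fundamental theorem is applied away from 0 and
    the interval is exhausted. *)
Lemma integral_powR (p b : R) : 0 < p -> 0 < b ->
  (\int[mu]_(s in `[0%R, b]) (p * s `^ (p - 1))%:E = (b `^ p)%:E)%E.
Proof.
move=> p0 b0.
(* The index [i.+2] keeps the left endpoint strictly below [b], already for i = 0. *)
pose F (i : nat) := `[b / i.+2%:R, b]%classic.
have mf D : measurable_fun D (fun s : R => (p * s `^ (p - 1))%:E).
  by apply/measurable_EFinP/measurable_funM => //; exact: measurable_powR_fun.
have F_cup : \bigcup_i F i = `]0, b]%classic.
  apply/seteqP; split => x.
    move=> [i _]; rewrite /F/= !in_itv/= => /andP[h ->]; rewrite andbT.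
    by apply: lt_le_trans h; rewrite divr_gt0.
  rewrite /= in_itv/= => /andP[x0 xb].
  exists (Num.bound (b / x)) => //; rewrite /F/= in_itv/= xb andbT.
  rewrite ler_pdivrMr// mulrC -ler_pdivrMr// ltW//.
  apply: lt_trans (archi_boundP _) _; first by rewrite divr_ge0// ltW.
  by rewrite ltr_nat.
have := @ge0_nondecreasing_set_cvg_integral _ (measurableTypeR R) R F
  (fun s => (p * s `^ (p - 1))%:E) mu.
rewrite F_cup => h.
rewrite -integral_itv_obnd_cbnd//.
have {}h : (\int[mu]_(s in F i) (p * s `^ (p - 1))%:E)%E @[i --> \oo] -->
    (\int[mu]_(s in `]0%R, b]) (p * s `^ (p - 1))%:E)%E.
  apply: h => //.
  - move=> i j ij; apply/subsetPset; rewrite /F; apply: subset_itvr; rewrite bnd_simp.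
    by rewrite ler_pM2l// lef_pV2 ?posrE// ler_nat.
  - by move=> i; exact: measurable_itv.
  - by move=> i; exact: mf.
  - by move=> i x _; rewrite lee_fin mulr_ge0 ?powR_ge0// ltW.
rewrite -(cvg_lim _ h)//; apply/cvg_lim => //.
have -> : (fun i => \int[mu]_(s in F i) (p * s `^ (p - 1))%:E)%E =
    (fun i => (b `^ p - (b * (i.+2%:R)^-1) `^ p)%:E).
  apply/funext => i; rewrite integral_powR_pos ?EFinB ?divr_gt0//.
  by rewrite ltr_pdivrMr// ltr_pMr// ltr1n.
apply: cvg_EFin; first by near=> i.
rewrite -[X in _ --> X]subr0; apply: cvgB; first exact: cvg_cst.
have h0 : b * (n.+2%:R)^-1 @[n --> \oo] --> (0 : R).
  rewrite -(mulr0 b); apply: cvgM; first exact: cvg_cst.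
  by rewrite (cvg_shiftS (@harmonic R)); exact: cvg_harmonic.
have /cvg_at_rightP := powR_cvg0 p0; apply; split => //.
by move=> i; rewrite divr_gt0.
Unshelve. all: by end_near. Qed.

Section weight.
Variable H : R.
Hypothesis H0 : 0 < H.
Let w (s : R) := s `^ (2 * H - 1).

Let H2 : 0 < 2 * H. Proof. by rewrite mulr_gt0. Qed.

Lemma integrable_weight (b : R) : 0 < b -> mu.-integrable `[0, b] (EFin \o w).
Proof.
move=> b0.
have mf : measurable_fun `[0, b] (fun s : R => (2 * H * w s)%:E).
  by apply/measurable_EFinP/measurable_funM => //; exact: measurable_powR_fun.
have i1 : mu.-integrable `[0, b] (fun s : R => (2 * H * w s)%:E).
  apply/integrableP; split => //.
  under eq_integral => s _ do rewrite gee0_abs ?lee_fin ?mulr_ge0 ?powR_ge0 ?(ltW H0)//.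
  by rewrite integral_powR// ltry.
have mI : measurable (`[0, b]%classic : set (measurableTypeR R)) by exact: measurable_itv.
have := integrableZl mI (2 * H)^-1 i1.
congr (_.-integrable _ _); apply/funext => s /=; rewrite -EFinM; congr EFin.
by rewrite mulrA mulVf ?mul1r// gt_eqF.
Qed.

Lemma Rintegral_weight (b : R) : 0 <= b ->
  \int[mu]_(s in `[0, b]) (H * w s) = b `^ (2 * H) / 2.
Proof.
rewrite le_eqVlt => /predU1P[<-|b0].
  by rewrite set_itv1 Rintegral_set1 powR0 ?mul0r// gt_eqF.
have := integral_powR H2 b0 => h.
transitivity (\int[mu]_(s in `[0, b]) (2^-1 * (2 * H * w s))).
  by apply: eq_Rintegral => s _; field.
rewrite RintegralZl//; last first.
  have mI : measurable (`[0, b]%classic : set (measurableTypeR R)) by exact: measurable_itv.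
  have := integrableZl mI (2 * H) (integrable_weight b0).
  by congr (_.-integrable _ _); apply/funext => s /=; rewrite -EFinM.
by rewrite /Rintegral h/= mulrC.
Qed.

Lemma integrable_weightM (b M : R) (f : R -> R) : 0 < b -> measurable_fun setT f ->
  (forall s, 0 <= s <= b -> `|f s| <= M) ->
  mu.-integrable `[0, b] (EFin \o (fun s => H * (w s * f s))).
Proof.
move=> b0 mf fM.
have mI : measurable (`[0, b]%classic : set (measurableTypeR R)) by exact: measurable_itv.
have i1 := integrableZl mI (H * M) (integrable_weight b0).
apply: le_integrable i1 => //.
  apply/measurable_EFinP/measurable_funM => //; apply: measurable_funM.
    exact: measurable_powR_fun.
  exact: measurable_funTS.
move=> s /=; rewrite in_itv/= => /fM sM; rewrite lee_fin !normrM (gtr0_norm H0).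
by rewrite -mulrA ler_pM2l// mulrC ler_wpM2r// (le_trans sM)// ler_norm.
Qed.

(** The weight is integrated exactly over ]x, y] and only [f] is bounded there, so a singularity at
    0 does no harm. No sign is imposed on [r] or [c], so the upper bound follows by negating
    both. *)
Lemma Rintegral_weightM_itv_ge (b M x y c r : R) (f : R -> R) : 0 <= x -> x <= y -> y <= b ->
  measurable_fun setT f -> (forall s, 0 <= s <= b -> `|f s| <= M) ->
  (forall s, x <= s <= y -> c <= r * f s) ->
  c * ((y `^ (2 * H) - x `^ (2 * H)) / 2) <=
  r * (\int[mu]_(s in `[0, y]) (H * (w s * f s)) - \int[mu]_(s in `[0, x]) (H * (w s * f s))).
Proof.
move=> x0 xy yb mf fM cf.
have y0 := le_trans x0 xy.
have [->|yx] := eqVneq y x; first by rewrite !subrr mul0r !mulr0.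
have {}xy : x < y by rewrite lt_neqAle eq_sym yx.
have {}y0 : 0 < y := le_lt_trans x0 xy.
have fMy s : 0 <= s <= y -> `|f s| <= M.
  by move=> /andP[s0 sy]; rewrite fM// s0 (le_trans sy).
have mI : measurable (`[0, y]%classic : set (measurableTypeR R)) by exact: measurable_itv.
have mJ : measurable (`]x, y]%classic : set (measurableTypeR R)) by exact: measurable_itv.
have JI : `]x, y] `<=` `[0, y].
  by apply: subset_itvr; rewrite bnd_simp.
have i1 := integrable_weightM y0 mf fMy.
have i2 : mu.-integrable `[0, y] (EFin \o (fun s => H * w s)).
  exact: (integrableZl mI H (integrable_weight y0)).
have rhsE : \int[mu]_(s in `[0, y]) (H * (w s * f s)) - \int[mu]_(s in `[0, x]) (H * (w s * f s)) =
    \int[mu]_(s in `]x, y]) (H * (w s * f s)).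
  by apply: Rintegral_itvB => //; rewrite bnd_simp// ltW.
have lhsE : (y `^ (2 * H) - x `^ (2 * H)) / 2 = \int[mu]_(s in `]x, y]) (H * w s).
  rewrite -(Rintegral_itvB i2) ?bnd_simp ?(ltW xy)//.
  by rewrite !Rintegral_weight ?(ltW y0)// mulrBl.
have j1 : mu.-integrable `]x, y] (EFin \o (fun s => H * (w s * f s))) by exact: integrableS i1.
have j2 : mu.-integrable `]x, y] (EFin \o (fun s => H * w s)) by exact: integrableS i2.
rewrite rhsE lhsE -!RintegralZl//.
apply: le_Rintegral => //.
- exact: (integrableZl mJ c j2).
- exact: (integrableZl mJ r j1).
move=> s; rewrite /= in_itv/= => /andP[xs sy].
rewrite [leRHS](_ : _ = (r * f s) * (H * w s)); last by ring.
by rewrite ler_wpM2r ?mulr_ge0 ?powR_ge0 ?(ltW H0)// cf// ltW.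
Qed.

Lemma Rintegral_weightM_itv_le (b M x y c r : R) (f : R -> R) : 0 <= x -> x <= y -> y <= b ->
  measurable_fun setT f -> (forall s, 0 <= s <= b -> `|f s| <= M) ->
  (forall s, x <= s <= y -> r * f s <= c) ->
  r * (\int[mu]_(s in `[0, y]) (H * (w s * f s)) - \int[mu]_(s in `[0, x]) (H * (w s * f s))) <=
  c * ((y `^ (2 * H) - x `^ (2 * H)) / 2).
Proof.
move=> x0 xy yb mf fM cf; rewrite -lerN2 -!mulNr.
by apply: (Rintegral_weightM_itv_ge x0 xy yb mf fM) => s sxy; rewrite mulNr lerN2 cf.
Qed.

End weight.
End powR_integral.

(** * Bounds, monotonicity and discretisation of [v] *)

Section fOU_variance.
Context (R : realType) (H : R).
Hypothesis H0 : 0 < H.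
Local Notation mu := (@lebesgue_measure R).

Let phi (theta t s : R) : R := expR (theta * s) + expR (theta * (2 * t - s)).
Let w (s : R) := s `^ (2 * H - 1).
(** Only the upper limit [x] moves, while [t] stays fixed inside [phi]; this is what lets [v]
    telescope over a grid of [0, t]. *)
Let VI (theta t x : R) := \int[mu]_(s in `[0, x]) (H * (w s * phi theta t s)).

Let H2 : 0 < 2 * H. Proof. by rewrite mulr_gt0. Qed.

Let measurable_phi theta t : measurable_fun setT (phi theta t).
Proof.
apply: measurable_funD; apply: measurableT_comp => //.
by apply: measurable_funM => //; exact: measurable_funB.
Qed.

Let phi_bounded theta t s : 0 <= s <= t ->
  `|phi theta t s| <= expR (`|theta| * t) + expR (`|theta| * (2 * t)).
Proof.
move=> /andP[s0 st]; rewrite ger0_norm ?addr_ge0 ?expR_ge0//.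
have := ler_norm theta; have := normr_ge0 theta => a0 a1.
by apply: lerD; rewrite ler_expR; nra.
Qed.

Let integrable_wphi theta t : 0 < t ->
  mu.-integrable `[0, t] (EFin \o (fun s => H * (w s * phi theta t s))).
Proof.
move=> t0; apply: (@integrable_weightM R H H0 t _ _ t0 (measurable_phi theta t)).
exact: phi_bounded.
Qed.

Let vE theta t : 0 < t -> v H theta t = VI theta t t.
Proof.
move=> t0; rewrite /VI /v -RintegralZl//.
have mI : measurable (`[0, t]%classic : set (measurableTypeR R)) by exact: measurable_itv.
have := integrableZl mI H^-1 (integrable_wphi theta t0).
congr (_.-integrable _ _); apply/funext => s /=; rewrite -EFinM; congr EFin.
by rewrite mulKf// gt_eqF.
Qed.

Let VI0 theta t : VI theta t 0 = 0.
Proof. by rewrite /VI set_itv1 Rintegral_set1. Qed.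

Let VI_ge theta t x y c r : 0 <= x -> x <= y -> y <= t ->
  (forall s, x <= s <= y -> c <= r * phi theta t s) ->
  c * ((y `^ (2 * H) - x `^ (2 * H)) / 2) <= r * (VI theta t y - VI theta t x).
Proof.
move=> x0 xy yt h.
exact: (@Rintegral_weightM_itv_ge R H H0 t _ x y c r _ x0 xy yt
  (measurable_phi theta t) (@phi_bounded theta t) h).
Qed.

Let VI_le theta t x y c r : 0 <= x -> x <= y -> y <= t ->
  (forall s, x <= s <= y -> r * phi theta t s <= c) ->
  r * (VI theta t y - VI theta t x) <= c * ((y `^ (2 * H) - x `^ (2 * H)) / 2).
Proof.
move=> x0 xy yt h.
exact: (@Rintegral_weightM_itv_le R H H0 t _ x y c r _ x0 xy yt
  (measurable_phi theta t) (@phi_bounded theta t) h).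
Qed.

Let pow0 : (0 : R) `^ (2 * H) = 0.
Proof. by rewrite powR0// gt_eqF. Qed.

Lemma v_ge theta t c : 0 < t -> (forall s, 0 <= s <= t -> c <= phi theta t s) ->
  c * (t `^ (2 * H) / 2) <= v H theta t.
Proof.
move=> t0 h; have := @VI_ge theta t 0 t c 1 (lexx _) (ltW t0) (lexx _).
by rewrite VI0 pow0 !subr0 mul1r vE//; apply => s /h; rewrite mul1r.
Qed.

Lemma v0E t : 0 < t -> v H 0 t = t `^ (2 * H).
Proof.
move=> t0; have phiE s : phi 0 t s = 2 by rewrite /phi !mul0r expR0.
have E2 : 2 * (t `^ (2 * H) / 2) = t `^ (2 * H) by field.
apply/eqP; rewrite eq_le; apply/andP; split.
  have := @VI_le 0 t 0 t 2 1 (lexx _) (ltW t0) (lexx _).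
  by rewrite VI0 pow0 !subr0 mul1r vE// E2; apply => s _; rewrite phiE mul1r.
by rewrite -{1}E2; apply: v_ge => // s _; rewrite phiE.
Qed.

Lemma v_gt0 theta t : 0 < t -> 0 < v H theta t.
Proof.
move=> t0; apply: (@lt_le_trans _ _ (expR (- (`|theta| * t)) * (t `^ (2 * H) / 2))).
  by rewrite mulr_gt0 ?expR_gt0// divr_gt0// powR_gt0.
apply: v_ge => // s /andP[s0 st]; rewrite -[leLHS]addr0 lerD ?expR_ge0// ler_expR.
have := ler_norm theta; have := ler_norm (- theta); rewrite normrN => a0 a1.
nra.
Qed.

(** The summand e^(theta (2t - s)) suffices, as 2t - s >= t. *)
Lemma v_ge_expR theta t : 0 <= theta -> 0 < t ->
  expR (theta * t) * (t `^ (2 * H) / 2) <= v H theta t.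
Proof.
move=> th0 t0; apply: v_ge => // s /andP[s0 st].
by rewrite -[leLHS]add0r lerD ?expR_ge0// ler_expR ler_wpM2l//; lra.
Qed.

Let v_compare theta theta' t a b : 0 < t ->
  (forall s, 0 <= s <= t -> a * phi theta t s <= b * phi theta' t s) ->
  a * v H theta t <= b * v H theta' t.
Proof.
move=> t0 h; rewrite (vE theta t0) (vE theta' t0) /VI.
have mI : measurable (`[0, t]%classic : set (measurableTypeR R)) by exact: measurable_itv.
rewrite -(RintegralZl _ mI (integrable_wphi theta t0)) -(RintegralZl _ mI (integrable_wphi theta' t0)).
apply: le_Rintegral => //.
- exact: (integrableZl mI a (integrable_wphi theta t0)).
- exact: (integrableZl mI b (integrable_wphi theta' t0)).
move=> s; rewrite /= in_itv/= => /h sh.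
rewrite mulrCA [leRHS]mulrCA ler_pM2l// mulrCA [leRHS]mulrCA ler_wpM2l//.
exact: powR_ge0.
Qed.

Lemma v_nondecreasing theta theta' t : 0 < t -> theta <= theta' ->
  v H theta t <= v H theta' t.
Proof.
move=> t0 th; rewrite -[leLHS]mul1r -[leRHS]mul1r.
apply: v_compare => // s /andP[s0 st]; rewrite !mul1r.
by apply: lerD; rewrite ler_expR ler_wpM2r//; lra.
Qed.

(** Dividing [phi] by e^(2 theta t) turns its exponents into theta (s - 2t) and -theta s, both
    nonincreasing in theta when 0 <= s <= t. *)
Lemma v_scaled_nonincreasing theta theta' t : 0 < t -> theta <= theta' ->
  expR (theta' * t) ^- 2 * v H theta' t <= expR (theta * t) ^- 2 * v H theta t.
Proof.
move=> t0 th; apply: v_compare => // s /andP[s0 st].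
rewrite /phi -!expRM_natl -!expRN !mulrDr -!expRD.
by apply: lerD; rewrite ler_expR; nra.
Qed.

(* The variance [S] of the discretised stochastic integral compares with [v] up to a
   factor tending to [1], hence its convergence needs no modulus of continuity. *)
Lemma v_discretization theta t (n : nat) (S : R) : 0 < t -> (0 < n)%N ->
  let h := t / n%:R in let q := expR (theta * h) in
  (1 + q) * S = \sum_(k < n) ((k.+1%:R * h) `^ (2 * H) - (k%:R * h) `^ (2 * H)) *
    (q ^+ ((2 * n).+1 - k) + q ^+ k.+2) ->
  S <= expR (3 * (`|theta| * h)) * v H theta t /\
  v H theta t <= expR (3 * (`|theta| * h)) * S.
Proof.
move=> t0 n0 h q SE; set L := `|theta| * h; set r := expR (3 * L).
have h0 : 0 < h by rewrite divr_gt0// ltr0n.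
have nh : n%:R * h = t by rewrite /h mulrCA divff ?mulr1// pnatr_eq0 -lt0n.
have thL : - L <= theta * h <= L.
  rewrite /L; have := ler_norm theta; have := ler_norm (- theta); rewrite normrN => a0 a1.
  by apply/andP; split; nra.
have /andP[Lth thL'] := thL.
have L0 : 0 <= L by rewrite mulr_ge0// ltW.
(* [a k] and [b k] are the two exponentials of [phi] taken at (k + 2)h and (k - 1)h. Both points are
   within 2h of any s in the k-th cell, which costs a factor e^(2L); comparing 2 / (1 + q) with 1
   costs another e^L, whence the constant 3. *)
pose a k := expR (theta * (k.+2%:R * h)).
pose b k := expR (theta * (2 * t - k%:R * h + h)).
pose c k : R := 2 / (1 + q) * (b k + a k).
have q1 : 0 < 1 + q by rewrite addr_gt0// expR_gt0.
have qa k : q ^+ k.+2 = a k by rewrite /q /a -expRM_natl; congr expR; ring.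
have qb k : (k < n)%N -> q ^+ ((2 * n).+1 - k) = b k.
  move=> kn; rewrite /q /b -expRM_natl natrB ?natrM; last by lia.
  by rewrite -nh -natr1 natrM; congr expR; ring.
have {}SE : S = \sum_(k < n) c k * (((k.+1%:R * h) `^ (2 * H) - (k%:R * h) `^ (2 * H)) / 2).
  apply: (@mulfI _ (1 + q)); first by rewrite gt_eqF.
  rewrite SE mulr_sumr; apply: eq_bigr => k _.
  by rewrite qa qb// /c; field; rewrite gt_eqF.
have bnd k s : k%:R * h <= s <= k.+1%:R * h ->
    c k <= r * phi theta t s /\ phi theta t s <= r * c k.
  rewrite -natr1 mulrDl mul1r => /andP[ks sk].
  have rE : r = expR L * expR (2 * L) by rewrite -expRD; congr expR; ring.
  have eL : expR (- L) <= q <= expR L by rewrite /q !ler_expR.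
  have /andP[eL1 eL2] := eL.
  have e1 : 1 <= expR L by rewrite -expR0 ler_expR.
  have c1 : 2 / (1 + q) <= expR L.
    rewrite ler_pdivrMr// mulrDr mulr1.
    have : 1 <= expR L * q by rewrite -(expRxMexpNx_1 L) ler_pM2l ?expR_gt0.
    lra.
  have c2 : 1 <= expR L * (2 / (1 + q)).
    rewrite mulrA ler_pdivlMr//; lra.
  have thu u : 0 <= u -> u <= 2 * h -> theta * u <= 2 * L /\ - (theta * u) <= 2 * L.
    move=> u0 u2; have := ler_norm theta; have := ler_norm (- theta); rewrite normrN /L => a0 a1.
    by split; nra.
  have [u1 u2] : theta * (k.+2%:R * h - s) <= 2 * L /\ - (theta * (k.+2%:R * h - s)) <= 2 * L.
    by apply: thu; rewrite -natr1 -natr1 !mulrDl; lra.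
  have [u3 u4] : theta * (s - k%:R * h + h) <= 2 * L /\ - (theta * (s - k%:R * h + h)) <= 2 * L.
    by apply: thu; lra.
  have ba1 : b k + a k <= expR (2 * L) * phi theta t s.
    rewrite /phi addrC mulrDr -!expRD; apply: lerD; rewrite ler_expR; lra.
  have ba2 : phi theta t s <= expR (2 * L) * (b k + a k).
    rewrite /phi /a /b addrC [leRHS]mulrDr -!expRD; apply: lerD; rewrite ler_expR; lra.
  have ba0 : 0 <= b k + a k by rewrite addr_ge0 ?expR_ge0.
  have ph0 : 0 <= phi theta t s by rewrite addr_ge0 ?expR_ge0.
  split; rewrite /c rE.
    by rewrite -[leRHS]mulrA; apply: ler_pM => //; apply: divr_ge0 => //; exact: ltW.
  rewrite [leRHS](_ : _ = (expR L * (2 / (1 + q))) * (expR (2 * L) * (b k + a k))); last by ring.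
  by rewrite -[leLHS]mul1r; apply: ler_pM.
have kle k : (k <= n)%N -> k%:R * h <= t by move=> kn; rewrite -nh ler_pM2r// ler_nat.
have k0 k : 0 <= k%:R * h :> R by rewrite mulr_ge0// ltW.
have kk k : k%:R * h <= k.+1%:R * h by rewrite ler_pM2r// ler_nat.
have vT : v H theta t = \sum_(k < n) (VI theta t (k.+1%:R * h) - VI theta t (k%:R * h)).
  rewrite -(big_mkord xpredT (fun k => VI theta t (k.+1%:R * h) - VI theta t (k%:R * h))).
  by rewrite telescope_sumr// nh mul0r VI0 subr0 vE.
rewrite SE vT !mulr_sumr; split; apply: ler_sum => k _.
  by apply: VI_ge => //; [exact: kle|move=> s /bnd[]].
rewrite mulrA -[leLHS]mul1r; apply: VI_le => //; first exact: kle.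
by move=> s /bnd[_]; rewrite mul1r.
Qed.

End fOU_variance.

(** * Pathwise convergence of the discounted sums *)

Lemma within_continuous_uniform (R : realType) (f : R -> R) (a b : R) :
  {within `[a, b], continuous f} -> forall e, 0 < e ->
  exists2 dl, 0 < dl & forall s u, a <= s <= b -> a <= u <= b ->
    `|s - u| < dl -> `|f s - f u| < e.
Proof.
move=> /subspace_continuousP cf e e0.
have e2 : 0 < e / 2 by rewrite divr_gt0.
have /compact_near_coveringP cpt := @segment_compact R a b.
(* [Q dl s] says that [dl] serves at [s] against every [u]. Near each x it holds for s within eta /
   2 of x and dl < eta / 2, and compactness yields one [dl] for all s. *)
pose Q (dl s : R) := a <= s <= b -> forall u, a <= u <= b -> `|s - u| < dl -> `|f s - f u| < e.
have : \forall dl \near (0 : R)^'+, `[a, b] `<=` Q dl.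
  apply: cpt => x xab.
  have [/= eta eta0 fx] := (cvgrPdist_lt _ _).1 (cf x xab) _ e2.
  have et2 : 0 < eta / 2 by rewrite divr_gt0.
  exists (ball x (eta / 2), [set dl | dl < eta / 2]) => /=.
    split; first exact: nbhsx_ballx.
    exact: nbhs_right_lt.
  move=> [s dl] /= [xs dleta] sab u uab sudl.
  rewrite -(subrKA (f x)) (splitr e) (le_lt_trans (ler_normD _ _))// ltrD//.
    rewrite distrC; apply: fx; last by rewrite /= in_itv.
    by apply: lt_le_trans xs _; rewrite ler_pdivrMr// ler_peMr// ?ler1n// ltW.
  apply: fx; last by rewrite /= in_itv.
  rewrite /= -(subrKA s) (splitr eta) (le_lt_trans (ler_normD _ _))// ltrD//.
  exact: lt_trans dleta.
move=> near_dl; have [dl [dl0 dlQ]] : exists dl, 0 < dl /\ `[a, b] `<=` Q dl.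
  near (0 : R)^'+ => dl; exists dl; split; first by near: dl; exact: nbhs_right_gt.
  by near: dl.
exists dl => // s u sab uab su.
by apply: (dlQ s) => //; rewrite /= in_itv.
Unshelve. all: by end_near. Qed.

Lemma within_continuous_bounded (R : realType) (f : R -> R) (a b : R) : a <= b ->
  {within `[a, b], continuous f} ->
  exists2 M, 0 <= M & forall s, a <= s <= b -> `|f s| <= M.
Proof.
move=> ab cf.
have [c _ fc] := EVT_max ab cf; have [c' _ fc'] := EVT_min ab cf.
exists (Num.max `|f c| `|f c'|); first by rewrite le_max normr_ge0.
move=> s sab; have sI : s \in `[a, b] by rewrite in_itv.
rewrite le_max ler_norml; have := fc s sI; have := fc' s sI.
have := ler_norm (f c); have := ler_norm (- f c'); rewrite normrN => h1 h2 h3 h4.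
have [h|/ltW h] := leP `|f c'| `|f c|; apply/orP; [left|right; rewrite ler_norml];
  apply/andP; split; lra.
Qed.

Lemma Rintegral_approx (R : realType) (x : R -> R) (a b c e : R) : 0 <= a -> a <= b ->
  (@lebesgue_measure R).-integrable `[0, b] (EFin \o x) ->
  (forall s, a <= s <= b -> `|c - x s| <= e) ->
  `|c * (b - a) - (\int[lebesgue_measure]_(s in `[0, b]) x s -
      \int[lebesgue_measure]_(s in `[0, a]) x s)| <= e * (b - a).
Proof.
move=> a0 ab ix xc.
rewrite (Rintegral_itvB ix) ?bnd_simp//.
have mJ : measurable (`]a, b]%classic : set (measurableTypeR R)) by exact: measurable_itv.
have JI : `]a, b] `<=` `[0, b] by apply: subset_itvr; rewrite bnd_simp.
have jx : (@lebesgue_measure R).-integrable `]a, b] (EFin \o x) by exact: integrableS ix.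
have muJ : fine (lebesgue_measure (`]a, b]%classic : set (measurableTypeR R))) = b - a.
  rewrite lebesgue_measure_itv/= lte_fin; case: ltP => //= ba.
  by apply/eqP; rewrite eq_sym subr_eq0 eq_le ab ba.
have jc k : (@lebesgue_measure R).-integrable `]a, b] (EFin \o cst k).
  apply/integrableP; split; first by apply/measurable_EFinP; exact: measurable_cst.
  rewrite /=.
  by rewrite integral_cst//= lebesgue_measure_itv/=; case: ifP; rewrite ?mule0// -EFinD -EFinM ltry.
have cI k : \int[lebesgue_measure]_(s in `]a, b]) (cst k s) = k * (b - a).
  by rewrite Rintegral_cst// muJ.
have h s : `]a, b]%classic s -> c - e <= x s <= c + e.
  rewrite /= in_itv/= => /andP[as_ sb]; have := xc s; rewrite (ltW as_) sb => /(_ isT).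
  by rewrite ler_norml => /andP[h1 h2]; apply/andP; split; lra.
have lo : (c - e) * (b - a) <= \int[lebesgue_measure]_(s in `]a, b]) x s.
  by rewrite -cI; apply: le_Rintegral => // s /h /andP[].
have hi : \int[lebesgue_measure]_(s in `]a, b]) x s <= (c + e) * (b - a).
  by rewrite -cI; apply: le_Rintegral => // s /h /andP[].
move: (\int[_]_(s in _) _) lo hi => I lo hi; clear -lo hi.
by rewrite ler_norml; apply/andP; split; lra.
Qed.

(** From 1 - z <= e^(-z) one gets e^z - 1 <= z e^z. With z = -theta h the bound is h times a
    quantity tending to 0, which survives summation over n cells. *)
Lemma norm_expR_sub1_le (R : realType) (z : R) : `|expR z - 1 - z| <= `|z| * `|expR z - 1|.
Proof.
have h1 := expR_ge1Dx z; have h2 := expR_ge1Dx (- z).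
have h3 : expR z * expR (- z) = 1 by rewrite expRxMexpNx_1.
have h4 := expR_gt0 z.
have h5 : expR z - 1 <= z * expR z by nra.
have h6 : `|z * (expR z - 1)| >= z * (expR z - 1) by exact: ler_norm.
rewrite -normrM; apply: le_trans h6; rewrite ger0_norm; last by lra.
lra.
Qed.

Section discounted_increments.
Context (R : realType) (x b : R -> R) (x0 theta t : R).
Local Notation mu := (@lebesgue_measure R).
Hypothesis t0 : 0 < t.
Hypothesis xint : forall s, 0 <= s -> mu.-integrable `[0, s] (EFin \o x).
Hypothesis xE : forall s, 0 <= s -> x s = x0 + theta * \int[mu]_(u in `[0, s]) x u + b s.
Hypothesis b0 : b 0 = 0.
Hypothesis bc : {within `[0, +oo[, continuous b}.

Let xx0 : x 0 = x0.
Proof. by rewrite xE// b0 set_itv1 Rintegral_set1 mulr0 !addr0. Qed.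

(** The right-hand side of the equation: its continuity can be read term by term, and it agrees with
    [x] at nonnegative times. *)
Let y (s : R) := x0 + theta * \int[mu]_(u in `[0, s]) x u + b s.

Let yc : {within `[0, t], continuous y}.
Proof.
move=> s; apply: cvgD; last first.
  apply: (continuous_subspaceW _ bc).
  by move=> u /=; rewrite !in_itv/= andbT => /andP[].
apply: cvgD; first exact: cvg_cst.
apply: cvgM; first exact: cvg_cst.
exact: (parameterized_integral_continuous (ltW t0) (xint (ltW t0))).
Qed.

Let yx s : 0 <= s -> y s = x s.
Proof. by move=> s0; rewrite /y -xE. Qed.

(** The error [E i] is multiplied by [q] at each step and receives a local error of order h e. One
    factor e^(|theta| t) bounds the growth over n steps, the other is a crude bound for the [q]
    inside [rho]. *)
Let discounted_increments_bound (n : nat) (M e : R) (h := t / n%:R) (q := expR (theta * h)) :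
  (0 < n)%N ->
  0 <= M -> 0 <= e -> (forall s, 0 <= s <= t -> `|y s| <= M) ->
  (forall s u, 0 <= s <= t -> 0 <= u <= t -> `|s - u| <= h -> `|y s - y u| <= e) ->
  `|expR (- (theta * h)) - 1| <= e ->
  `|\sum_(i < n) q ^+ (n - i) * (b (i.+1%:R * h) - b (i%:R * h)) - (x t - expR (theta * t) * x0)| <=
  expR (`|theta| * t) ^+ 2 * (`|theta| * t) * (M + 1) * e.
Proof.
move=> n0 M0 e0 yM ye qe.
have h0 : 0 < h by rewrite divr_gt0// ltr0n.
have nh : n%:R * h = t by rewrite /h mulrCA divff ?mulr1// pnatr_eq0 -lt0n.
have kle k : (k <= n)%N -> 0 <= k%:R * h <= t.
  by move=> kn; rewrite mulr_ge0 ?(ltW h0)//= -nh ler_pM2r// ler_nat.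
(* A single path is a random variable on a one-point space, so [discount_sum] applies to it. *)
pose D i (_ : unit) := b (i.+1%:R * h) - b (i%:R * h).
pose W i := discount_sum q D i tt.
pose E i := W i - (x (i%:R * h) - q ^+ i * x0).
pose Q := expR (`|theta| * h).
have q0 : 0 < q := expR_gt0 _.
have qQ : q <= Q by rewrite ler_expR ler_wpM2r ?ler_norm// ltW.
have Q1 : 1 <= Q by rewrite -expR0 ler_expR mulr_ge0// ltW.
(* In [M + 1], the 1 accounts for the oscillation of the path within a cell, and [M] for replacing
   the exponential by its first-order expansion. *)
pose rho := q * (`|theta| * h * ((M + 1) * e)).
have rho0 : 0 <= rho by rewrite /rho; do ?[apply: mulr_ge0 | apply: addr_ge0] => //; exact: ltW.
have EB i : (i <= n)%N -> `|E i| <= i%:R * Q ^+ i * rho.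
  elim: i => [_|i IH i1n].
    by rewrite /E /W/= !mul0r xx0 expr0 mul1r subrr subrr normr0.
  have /IH {}IH : (i <= n)%N := ltnW i1n.
  set c := x (i.+1%:R * h).
  set I := \int[mu]_(u in `[0, i.+1%:R * h]) x u - \int[mu]_(u in `[0, i%:R * h]) x u.
  have /andP[s0 st] := kle _ (ltnW i1n).
  have /andP[s0' st'] := kle _ i1n.
  have ih : i.+1%:R * h - i%:R * h = h by rewrite -mulrBl -natr1 addrAC subrr add0r mul1r.
  have cI : `|c * h - I| <= e * h.
    rewrite -{1 2}ih; apply: Rintegral_approx => //.
    - by rewrite -subr_ge0 ih ltW.
    - exact: xint.
    - move=> s /andP[is_ si]; rewrite /c -!yx//; last exact: le_trans is_.
      apply: ye; first exact: kle.
        by rewrite (le_trans s0 is_) (le_trans si).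
      rewrite ger0_norm ?subr_ge0//; lra.
  (* The increment of [b] becomes that of [x] minus theta [I], and the remaining [c] is written as q
     e^(-theta h) c to factor out [q]. *)
  have ES : E i.+1 = q * E i +
      q * (theta * (c * h - I) - (expR (- (theta * h)) - 1 - - (theta * h)) * c).
    have qV : q * expR (- (theta * h)) = 1 by rewrite expRxMexpNx_1.
    rewrite /E /W /= -/(W i) /D exprS -/c.
    have -> : b (i.+1%:R * h) - b (i%:R * h) = c - x (i%:R * h) - theta * I.
      by rewrite /c !xE// /I; ring.
    rewrite [RHS](_ : _ = q * (W i - (x (i%:R * h) - q ^+ i * x0)) + q * theta * (c * h - I) -
       ((q * expR (- (theta * h))) - q + q * (theta * h)) * c); last by ring.
    by rewrite qV; ring.
  have cM : `|c| <= M by rewrite /c -yx// yM// kle.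
  have z1 := norm_expR_sub1_le (- (theta * h)).
  have n1 : `|q * (theta * (c * h - I) - (expR (- (theta * h)) - 1 - - (theta * h)) * c)| <= rho.
    rewrite normrM (gtr0_norm q0) ler_pM2l//.
    rewrite (_ : `|theta| * h * ((M + 1) * e) =
      `|theta| * (e * h) + (`|theta| * h * e) * M); last by ring.
    apply: (le_trans (ler_normB _ _)); apply: lerD; rewrite normrM.
      by rewrite ler_wpM2l.
    apply: ler_pM => //; apply: (le_trans z1).
    by rewrite normrN normrM (gtr0_norm h0) ler_wpM2l// mulr_ge0// ltW.
  rewrite ES (le_trans (ler_normD _ _))//.
  rewrite normrM (gtr0_norm q0).
  rewrite [leRHS](_ : _ = Q * (i%:R * Q ^+ i * rho) + Q ^+ i.+1 * rho); last first.
    by rewrite -natr1 exprS; ring.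
  apply: lerD; first by apply: ler_pM => //; exact: ltW.
  apply: (le_trans n1); rewrite ler_peMl//; exact: exprn_ege1.
have := EB n (leqnn n).
have qn : q ^+ n = expR (theta * t) by rewrite /q -expRM_natl mulrCA nh.
rewrite /E /W discount_sumE nh qn => /le_trans; apply.
have Qn : Q ^+ n = expR (`|theta| * t) by rewrite /Q -expRM_natl mulrCA nh.
have Qt : q <= expR (`|theta| * t).
  by rewrite (le_trans qQ)// -Qn -{1}[Q]expr1 ler_weXn2l.
rewrite Qn /rho.
rewrite [leLHS](_ : _ =
  q * (expR (`|theta| * t) * (`|theta| * (n%:R * h)) * ((M + 1) * e))); last by ring.
rewrite nh [leRHS](_ : _ =
  expR (`|theta| * t) * (expR (`|theta| * t) * (`|theta| * t) * ((M + 1) * e))); last by ring.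
by apply: ler_wpM2r => //; rewrite !mulr_ge0 ?expR_ge0 ?addr_ge0 ?(ltW t0).
Qed.

Lemma discounted_increments_cvg (h := fun n : nat => t / n%:R) :
  \sum_(i < n) expR (theta * h n) ^+ (n - i) * (b (i.+1%:R * h n) - b (i%:R * h n))
    @[n --> \oo] --> x t - expR (theta * t) * x0.
Proof.
have [M M0 yM] := within_continuous_bounded (ltW t0) yc.
pose C := expR (`|theta| * t) ^+ 2 * (`|theta| * t) * (M + 1).
have C0 : 0 <= C by rewrite !mulr_ge0 ?exprn_ge0 ?expR_ge0 ?addr_ge0 ?(ltW t0).
apply/cvgrPdist_le => /= e e0.
(* [C] is 0 when theta = 0, hence the division by [C + 1]. *)
have C1 : 0 < C + 1 by rewrite ltr_wpDl.
pose e' := e / (C + 1).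
have e'0 : 0 < e' by rewrite divr_gt0.
have [dl dl0 ydl] := within_continuous_uniform yc e'0.
have h0 : h n @[n --> \oo] --> (0 : R).
  rewrite -(mulr0 t); apply: cvgM; first exact: cvg_cst.
  by apply/gtr0_cvgV0; [near=> n; rewrite ltr0n; near: n; exact: nbhs_infty_gt|exact: cvgr_idn].
have q0 : expR (- (theta * h n)) @[n --> \oo] --> (1 : R).
  rewrite -expR0; apply: continuous_cvg; first exact: continuous_expR.
  by rewrite -oppr0 -(mulr0 theta); apply: cvgN; apply: cvgM => //; exact: cvg_cst.
near=> n.
have n0 : (0 < n)%N by near: n; exact: nbhs_infty_gt.
rewrite distrC; apply: (@le_trans _ _ (C * e')); last first.
  by rewrite /e' mulrCA ger_pMr// ler_pdivrMr// mul1r lerDl.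
apply: discounted_increments_bound => //.
- exact: ltW.
- move=> s u st ut su; apply/ltW/ydl => //; apply: (le_lt_trans su).
  near: n; have /cvgrPdist_lt/(_ _ dl0) := h0; apply: filterS => n.
  by rewrite sub0r normrN => /ltr_normlW.
- near: n; have /cvgrPdist_le/(_ _ e'0) := q0; apply: filterS => n.
  by rewrite distrC.
Unshelve. all: by end_near. Qed.

End discounted_increments.

(** * Law of the fractional Ornstein-Uhlenbeck process *)

(** Up to a null set, [A] lies in the increasing union of the tail intersections [G k], and each
    [G k] lies in [An k]; continuity from below concludes. Being one-sided, it is applied to a ray
    and to the complement of a ray. *)
Lemma probability_le_cvg d (T : measurableType d) (R : realType) (P : probability T R)
    (A : set T) (An : (set T)^nat) (c : R) :
  measurable A -> (forall n, measurable (An n)) ->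
  {ae P, forall w, A w -> \forall n \near \oo, An n w} ->
  (forall e, 0 < e -> \forall n \near \oo, (P (An n) <= (c + e)%:E)%E) ->
  (P A <= c%:E)%E.
Proof.
move=> mA mAn [N [mN N0 AN]] Pc.
pose G k := \bigcap_(n in [set n | (k <= n)%N]) An n.
have mG k : measurable (G k) by apply: bigcap_measurable => //; exists k => /=.
have ndG : nondecreasing_seq G.
  move=> i j ij; apply/subsetPset => w Gw n /= jn; apply: Gw => /=.
  exact: leq_trans jn.
have AG : A `<=` N `|` \bigcup_k G k.
  move=> w Aw; have [wN|wN] := pselect (N w); first by left.
  right; have : \forall n \near \oo, An n w.
    by apply: contrapT => nw; apply/wN/AN => /= /(_ Aw).
  by move=> [k _ kw]; exists k => // n /= kn; exact: kw.
apply: (@le_trans _ _ (P (\bigcup_k G k))).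
  apply: (le_trans (le_measure _ _ _ AG)); rewrite ?inE//.
    by apply: measurableU => //; exact: bigcup_measurable.
  have mU : measurable (\bigcup_k G k) by exact: bigcup_measurable.
  have := measureU2 P mN mU.
  by rewrite [X in (_ <= X + _)%E]N0 add0e.
have cvgG : P (G k) @[k --> \oo] --> P (\bigcup_k G k).
  exact: nondecreasing_cvg_mu mG (bigcup_measurable (fun k _ => mG k)) ndG.
apply/lee_addgt0Pr => e e0; rewrite -EFinD.
apply: (cvge_to_le cvgG).
apply: filterS (Pc e e0) => n; apply: le_trans.
apply: le_measure; rewrite ?inE; [exact: mG|exact: mAn|].
by move=> w; apply => /=.
Qed.

Section discretized_fOU.
Context d (T : measurableType d) (R : realType) (P : probability T R).
Variables (H : R) (B : R -> {RV P >-> R}).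
Hypothesis H0 : 0 < H.
Hypothesis BfBm : fBm P H B.

Let H2 : 2 * H != 0. Proof. by rewrite gt_eqF// mulr_gt0. Qed.

Let covE (t s : R) : 0 <= t -> 0 <= s ->
  (\int[P]_w (B t w * B s w)%:E =
   (2^-1 * (`|t| `^ (2 * H) + `|s| `^ (2 * H) - `|t - s| `^ (2 * H)))%:E)%E.
Proof. by move=> t0 s0; have [_ _ + _] := BfBm; move=> /(_ t s t0 s0) <-; rewrite unlock. Qed.

Let meanE (t : R) : 0 <= t -> (\int[P]_w (B t w)%:E = 0)%E.
Proof. by move=> t0; have [_ + _ _] := BfBm; move=> /(_ t t0) <-; rewrite unlock. Qed.

Let sqintB (t : R) : 0 <= t -> sqint P (B t).
Proof.
move=> t0; split => //; apply/integrableP; split.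
  by apply/measurable_EFinP; exact: measurable_funX.
under eq_integral do rewrite /= ger0_norm ?sqr_ge0// expr2.
by rewrite covE// ltry.
Qed.

Let innerB (t s : R) : 0 <= t -> 0 <= s ->
  inner P (B t) (B s) = 2^-1 * (`|t| `^ (2 * H) + `|s| `^ (2 * H) - `|t - s| `^ (2 * H)).
Proof. by move=> t0 s0; rewrite /inner /Rintegral covE. Qed.

(** The covariance at (0, 0) vanishes, so [B 0] has zero second moment. The pathwise convergence
    relies on the noise starting at 0. *)
Lemma fBm_at0 : {ae P, forall w, B 0 w = 0}.
Proof.
have := @covE 0 0 (lexx _) (lexx _).
rewrite subrr normr0 powR0// addr0 subr0 mulr0 => h.
have [mB _] := @sqintB 0 (lexx _).
have m2 : measurable_fun setT (fun w => (B 0 w * B 0 w)%:E).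
  by apply/measurable_EFinP; exact: measurable_funM.
have : ae_eq P setT (fun w => (B 0 w * B 0 w)%:E) (cst 0%E).
  apply/ae_eq_integral_abs => //; apply: etrans h; apply: eq_integral => w _.
  by rewrite gee0_abs// lee_fin -expr2 sqr_ge0.
apply: filterS => w /(_ I) [] /eqP; rewrite mulf_eq0 orbb => /eqP.
exact.
Qed.

Variables (theta t : R) (n : nat).
Hypothesis t0 : 0 < t.
Hypothesis n0 : (0 < n)%N.
Let h := t / n%:R.
Let q := expR (theta * h).
Let h0 : 0 < h. Proof. by rewrite divr_gt0// ltr0n. Qed.
(** The difference is written with [-1 *] to match [sqintD], [sqintZ] and the linearity of
    [inner]. *)
Let D (i : nat) (w : T) : R := B (i.+1%:R * h) w + -1 * B (i%:R * h) w.

Let s0 i : 0 <= i%:R * h :> R. Proof. by rewrite mulr_ge0// ltW. Qed.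

Let sqintD_ i : sqint P (D i).
Proof. by apply: sqintD; [exact: sqintB|apply: sqintZ; exact: sqintB]. Qed.

Let f (k : nat) := (k%:R * h) `^ (2 * H).
Let dl (k : nat) := f k.+1 - f k.

Let inner_grid i k : inner P (B (i%:R * h)) (B ((i + k)%:R * h)) = 2^-1 * (f i + f (i + k) - f k).
Proof.
rewrite innerB// distrC (ger0_norm (s0 i)) (ger0_norm (s0 (i + k))) -mulrBl.
by rewrite -natrB ?leq_addr// addKn (ger0_norm (s0 k)).
Qed.

Let inner_DD i g : sqint P g ->
  inner P (D i) g = inner P (B (i.+1%:R * h)) g - inner P (B (i%:R * h)) g.
Proof.
move=> sg; rewrite /D innerDl//; [|exact: sqintB|apply: sqintZ; exact: sqintB].
by rewrite innerZl ?mulN1r//; exact: sqintB.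
Qed.

Let inner_diag i : inner P (D i) (D i) = dl 0.
Proof.
rewrite inner_DD// ![inner P (B _) (D i)]inner_sym !inner_DD//; try exact: sqintB.
rewrite [inner P (B (i.+1%:R * h)) (B (i%:R * h))]inner_sym.
have e1 := inner_grid i 0; have e2 := inner_grid i.+1 0; have e3 := inner_grid i 1.
rewrite !addn0 in e1 e2; rewrite addn1 in e3; rewrite e1 e2 e3 /dl /f.
by rewrite mul0r powR0//; field.
Qed.

(** In the four covariances all terms depending on the position [i] cancel, leaving half a second
    difference of [f] at the lag. *)
Let inner_off i k : inner P (D i) (D (i + k.+1)%N) = (dl k.+1 - dl k) / 2.
Proof.
rewrite inner_DD// ![inner P (B _) (D _)]inner_sym !inner_DD//; try exact: sqintB.
rewrite ![inner P (B ((i + k.+1).+1%:R * h)) _]inner_sym ![inner P (B ((i + k.+1)%:R * h)) _]inner_sym.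
have e1 := inner_grid i k.+1; have e2 := inner_grid i k.+2.
have e3 := inner_grid i.+1 k.+1; have e4 := inner_grid i.+1 k.
rewrite addnS in e2; rewrite addSn in e3; rewrite addSnnS in e4.
by rewrite e1 e2 e3 e4 /dl addnS; field.
Qed.

Let W := discount_sum q D n.

Let sqintW : sqint P W.
Proof. exact: sqint_discount_sum. Qed.

Let meanW : (\int[P]_w (W w)%:E = 0)%E.
Proof.
have s1 : sqint P (cst 1).
  split; first exact: measurable_cst.
  by have := finite_measure_integrable_cst P (1 ^+ 2 : R); apply.
have iW := sqint_integrable sqintW.
rewrite -(@fineK _ (\int[P]_w (W w)%:E)%E); last exact: integrable_fin_num.
have D0 i : inner P (D i) (cst 1) = 0.
  have B1 s : 0 <= s -> inner P (B s) (cst 1) = 0.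
    move=> s0'; rewrite /inner; under eq_Rintegral do rewrite mulr1.
    by rewrite /Rintegral meanE.
  by rewrite inner_DD// !B1// subrr.
have : inner P W (cst 1) = 0.
  by rewrite inner_discount_sum_l// big1// => i _; rewrite D0 mulr0.
by rewrite /inner; under eq_Rintegral do rewrite mulr1; rewrite /Rintegral => ->.
Qed.

Let S := inner P W W.

Let discretized_variance :
  S <= expR (3 * (`|theta| * h)) * v H theta t /\
  v H theta t <= expR (3 * (`|theta| * h)) * S.
Proof.
apply: v_discretization => //.
exact: (inner_discount_sum q sqintD_ inner_diag inner_off n).
Qed.

Let WE w : W w = \sum_(i < n) q ^+ (n - i) * (B (i.+1%:R * h) w - B (i%:R * h) w).
Proof. by rewrite /W discount_sumE; apply: eq_bigr => i _; rewrite /D mulN1r. Qed.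

Let gaussianW : gaussian_rv P W.
Proof.
have [gB _ _ _] := BfBm.
(* The Gaussian hypothesis concerns values of [B], so n increments become 2n values: right endpoints
   come first, then left endpoints with the opposite coefficient. *)
pose ts (i : 'I_(n + n)) : R := match fintype.split i with inl j => j.+1%:R * h | inr j => j%:R * h end.
pose aa (i : 'I_(n + n)) : R :=
  match fintype.split i with inl j => q ^+ (n - j) | inr j => - q ^+ (n - j) end.
have tt0 i : 0 <= ts i by rewrite /ts; case: (fintype.split i).
have := gB _ ts aa tt0; congr (gaussian_rv P _); apply/funext => w.
rewrite WE big_split_ord/= -big_split/=; apply: eq_bigr => j _.
rewrite /ts /aa -[lshift _ _]/(unsplit (inl j)) -[rshift _ _]/(unsplit (inr j)) !unsplitK.
by rewrite mulrBr mulNr.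
Qed.

Lemma discretized_law : exists S,
  [/\ S <= expR (3 * (`|theta| * h)) * v H theta t,
      v H theta t <= expR (3 * (`|theta| * h)) * S &
      forall y, let A := [set w | \sum_(i < n) q ^+ (n - i) *
        (B (i.+1%:R * h) w - B (i%:R * h) w) <= y] in
      measurable A /\ P A = (Phi (y / Num.sqrt S))%:E].
Proof.
have [S1 S2] := discretized_variance; exists S; split => // y A.
have mW : measurable_fun setT W by case: sqintW.
pose Y : {mfun T >-> R} := HB.pack W (isMeasurableFun.Build _ _ _ _ W mW).
have -> : A = [set w | Y w <= y].
  by rewrite /A; apply/seteqP; split => w /=; rewrite -WE.
split.
  have := measurable_funPTI Y (measurable_itv `]-oo, y]).
  by congr measurable; apply/seteqP; split => w /=; rewrite in_itv.
apply: gaussian_rv_cdf.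
- have := lt_le_trans (v_gt0 H0 theta t0) S2; rewrite pmulr_rgt0//; exact: expR_gt0.
- exact: gaussianW.
- exact: sqint_integrable sqintW.
- by case: sqintW.
- exact: meanW.
- have i2 : (\int[P]_w (W w ^+ 2)%:E)%E \is a fin_num by apply: integrable_fin_num => //; case: sqintW.
  by rewrite -(fineK i2); congr EFin.
Qed.

End discretized_fOU.

Section fOU_law.
Context d (T : measurableType d) (R : realType) (P : probability T R).
Variables (H x0 theta : R) (X : R -> {mfun T >-> R}).
Hypothesis H0 : 0 < H.
Hypothesis XfOU : fOU P H x0 theta X.
Variable t : R.
Hypothesis t0 : 0 < t.

Let sg := Num.sqrt (v H theta t).
Let sg0 : 0 < sg. Proof. by rewrite sqrtr_gt0 v_gt0. Qed.
Let Y (w : T) := X t w - expR (theta * t) * x0.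

Let mY : measurable_fun setT Y.
Proof. by apply: measurable_funB. Qed.

Let mYle (y : R) : measurable [set w | Y w <= y].
Proof.
have := mY measurableT (measurable_itv `]-oo, y]); rewrite setTI.
by congr measurable; apply/seteqP; split => w /=; rewrite in_itv.
Qed.

(** [A y n] is the event that the n-th discretised sum is at most [y]. With this packaging the law
    of the limit is derived without further reference to [B]. *)
Let scale_cvg : exists S : nat -> R, exists A : R -> nat -> set T,
  [/\ S n @[n --> \oo] --> v H theta t,
    forall y n, measurable (A y n) /\ P (A y n) = (Phi (y / Num.sqrt (S n)))%:E &
    {ae P, forall w, exists2 u : nat -> R, u n @[n --> \oo] --> Y w &
      forall y n, A y n w <-> u n <= y}].
Proof.
have [B [BfBm Xeq]] := XfOU.
(* Grids have [n.+1] cells, since [discretized_law] requires at least one. *)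
have /choice[S SP] := fun n : nat => discretized_law H0 BfBm theta t0 (ltn0Sn n).
exists S.
pose u n w := \sum_(i < n) expR (theta * (t / n%:R)) ^+ (n - i) *
  (B (i.+1%:R * (t / n%:R)) w - B (i%:R * (t / n%:R)) w).
exists (fun y n => [set w | u n.+1 w <= y]); split.
- have vp := v_gt0 H0 theta t0.
  have r1 : expR (3 * (`|theta| * (t / n.+1%:R))) @[n --> \oo] --> (1 : R).
    rewrite -[X in _ --> X]expR0; apply: continuous_cvg; first exact: continuous_expR.
    rewrite -[X in _ --> X](mulr0 3); apply: cvgM; first exact: cvg_cst.
    rewrite -[X in _ --> X](mulr0 `|theta|); apply: cvgM; first exact: cvg_cst.
    rewrite -[X in _ --> X](mulr0 t); apply: cvgM; first exact: cvg_cst.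
    exact: cvg_harmonic.
  apply: (@squeeze_cvgr _ _ _ _ (fun n => v H theta t / expR (3 * (`|theta| * (t / n.+1%:R))))
    (fun n => expR (3 * (`|theta| * (t / n.+1%:R))) * v H theta t)).
  + near=> n; have [S1 S2 _] := SP n; rewrite S1 andbT.
    by rewrite ler_pdivrMr ?expR_gt0// mulrC.
  + rewrite -[X in _ --> X]divr1; apply: cvgM; first exact: cvg_cst.
    by apply: cvgV => //; rewrite oner_eq0.
  + rewrite -[X in _ --> X]mul1r; apply: cvgM => //; exact: cvg_cst.
- by move=> y n; have [_ _] := SP n; apply.
- have [_ _ _ Bc] := BfBm.
  have B0 := fBm_at0 H0 BfBm.
  apply: filterS3 Xeq Bc B0 => w Xw Bcw B0w.
  exists (fun n => u n.+1 w) => //.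
  have xint s : 0 <= s -> (@lebesgue_measure R).-integrable `[0, s] (EFin \o (fun s => X s w)).
    by move=> /Xw[].
  have xE s : 0 <= s -> X s w = x0 + theta * \int[lebesgue_measure]_(u in `[0, s]) X u w + B s w.
    by move=> /Xw[].
  rewrite (cvg_shiftS (fun n => u n w)).
  exact: discounted_increments_cvg t0 xint xE B0w Bcw.
Unshelve. all: by end_near. Qed.

Let Phi_scale_cvg (S : nat -> R) (y : R) : S n @[n --> \oo] --> v H theta t ->
  Phi (y / Num.sqrt (S n)) @[n --> \oo] --> Phi (y / sg).
Proof.
move=> Sv; apply: continuous_cvg; first exact: Phi_continuous.
apply: cvgM; first exact: cvg_cst.
apply: cvgV; first by rewrite gt_eqF.
by apply: continuous_cvg => //; exact: sqrt_continuous.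
Qed.

(** If Y <= y then the sums are eventually at most y + z for any z > 0, and continuity of [Phi] lets
    z tend to 0; this is the upper bound. The lower bound comes from the complement. *)
Lemma fOU_centered_cdf (y : R) : P [set w | X t w - expR (theta * t) * x0 <= y] = (Phi (y / sg))%:E.
Proof.
have [S [A [Sv AP Aw]]] := scale_cvg.
apply/eqP; rewrite eq_le; apply/andP; split.
  apply/lee_addgt0Pr => e e0; rewrite -EFinD.
  have /cvgrPdist_lt/(_ _ e0) : Phi ((y + z) / sg) @[z --> 0^'+] --> Phi (y / sg).
    apply: continuous_cvg; first exact: Phi_continuous.
    apply: cvgM; last exact: cvg_cst.
    rewrite -[X in _ --> X]addr0; apply: cvgD; first exact: cvg_cst.
    exact: cvg_at_right_filter.
  move=> he.
  have [z [z0 /ltW hz]] : exists z, 0 < z /\ `|Phi (y / sg) - Phi ((y + z) / sg)| < e.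
    near (0 : R)^'+ => z; exists z; split; last by near: z.
    by near: z; exact: nbhs_right_gt.
  apply: (@le_trans _ _ (Phi ((y + z) / sg))%:E); last first.
    by rewrite lee_fin; move: hz; rewrite ler_norml => /andP[h1 h2]; lra.
  apply: (@probability_le_cvg _ _ _ P _ (A (y + z))) => //.
  - by move=> n; case: (AP (y + z) n).
  - apply: filterS Aw => w [u uY uA] Yw.
    have yz : Y w < y + z by rewrite (le_lt_trans Yw)// ltrDl.
    have /cvgrPdist_lt/(_ (y + z - Y w)) := uY; rewrite subr_gt0 => /(_ yz).
    apply: filterS => n un; apply/uA.
    by move: un; rewrite ltr_norml => /andP[h1 h2]; lra.
  - move=> e' e'0; have /cvgrPdist_lt/(_ _ e'0) := @Phi_scale_cvg S (y + z) Sv.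
    apply: filterS => n; have [_ ->] := AP (y + z) n.
    by rewrite lee_fin ltr_norml => /andP[h1 h2]; lra.
pose L := [set w | Y w <= y].
have : (P (~` L) <= (1 - Phi (y / sg))%:E)%E.
  apply: (@probability_le_cvg _ _ _ P _ (fun n => ~` A y n)).
  - by apply: measurableC; exact: mYle.
  - by move=> n; apply: measurableC; case: (AP y n).
  - apply: filterS Aw => w [u uY uA] /= /negP; rewrite -ltNge => yY.
    have /cvgrPdist_lt/(_ (Y w - y)) := uY; rewrite subr_gt0 => /(_ yY).
    apply: filterS => n un /uA.
    by move: un; rewrite ltr_norml => /andP[h1 h2] h3; lra.
  - move=> e' e'0; have /cvgrPdist_lt/(_ _ e'0) := @Phi_scale_cvg S y Sv.
    apply: filterS => n; have [mA PA] := AP y n; rewrite probability_setC// PA -EFinB.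
    by rewrite lee_fin ltr_norml => /andP[h1 h2]; lra.
rewrite probability_setC; last exact: mYle.
have fP : P L \is a fin_num by apply: fin_num_measure; exact: mYle.
rewrite -[[set w | X t w - _ <= y]]/L.
rewrite -(fineK fP) -EFinB !lee_fin; lra.
Unshelve. all: by end_near. Qed.

End fOU_law.

(** * The test *)

Lemma fOU_exceedance d (T : measurableType d) (R : realType) (P : probability T R)
    (H x0 theta : R) (X : R -> {mfun T >-> R}) (t K : R) :
  0 < H -> fOU P H x0 theta X -> 0 < t -> 0 <= K ->
  P [set w | K < `|X t w|] =
  (1 - (Phi ((K - x0 * expR (theta * t)) / Num.sqrt (v H theta t)) +
        Phi ((K + x0 * expR (theta * t)) / Num.sqrt (v H theta t)) - 1))%:E.
Proof.
move=> H0 XfOU t0 K0.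
set sg := Num.sqrt _; set m := x0 * _.
have sg0 : 0 < sg by rewrite sqrtr_gt0 v_gt0.
have mX : measurable_fun setT (X t) by [].
have mle y : measurable [set w | X t w <= y].
  have := mX measurableT _ (measurable_itv `]-oo, y]); rewrite setTI.
  by congr measurable; apply/seteqP; split => w /=; rewrite in_itv.
have mlt y : measurable [set w | X t w < y].
  have := mX measurableT _ (measurable_itv `]-oo, y[); rewrite setTI.
  by congr measurable; apply/seteqP; split => w /=; rewrite in_itv.
have cdf y : P [set w | X t w <= y] = (Phi ((y - m) / sg))%:E.
  rewrite -(fOU_centered_cdf H0 XfOU t0); congr (P _); apply/seteqP; split => w /=;
  by rewrite /m mulrC; lra.
(* The lower tail is a strict inequality; the law has no atom because [Phi] is continuous. *)
have cdflt y : P [set w | X t w < y] = (Phi ((y - m) / sg))%:E.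
  apply/eqP; rewrite eq_le; apply/andP; split.
    rewrite -cdf; apply: le_measure; rewrite ?inE//.
    by move=> w /=; exact: ltW.
  apply/lee_addgt0Pr => e e0.
  have /cvgrPdist_lt/(_ _ e0) he : Phi ((y - z - m) / sg) @[z --> 0^'+] --> Phi ((y - m) / sg).
    apply: continuous_cvg; first exact: Phi_continuous.
    apply: cvgM; last exact: cvg_cst.
    apply: cvgB; last exact: cvg_cst.
    rewrite -[X in _ --> X]subr0; apply: cvgB; first exact: cvg_cst.
    exact: cvg_at_right_filter.
  have [z [z0 /ltW hz]] : exists z, 0 < z /\ `|Phi ((y - m) / sg) - Phi ((y - z - m) / sg)| < e.
    near (0 : R)^'+ => z; exists z; split; last by near: z.
    by near: z; exact: nbhs_right_gt.
  pose L := [set w | X t w <= y - z].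
  apply: (@le_trans _ _ (P L + e%:E)%E).
    by rewrite cdf -EFinD lee_fin; move: hz; rewrite ler_norml => /andP[h1 h2]; lra.
  rewrite leeD2r//; apply: le_measure; rewrite ?inE; [exact: mle|exact: mlt|].
  by move=> w /= /le_lt_trans; apply; rewrite ltrBlDr ltrDl.
have -> : [set w | K < `|X t w|] = [set w | X t w < - K] `|` ~` [set w | X t w <= K].
  apply/seteqP; split => w /=.
    rewrite ltr_normr => /orP[h|h]; last by left; rewrite ltrNr.
    by right; apply/negP; rewrite -ltNge.
  case=> [h|/negP]; rewrite ltr_normr; first by rewrite [X in _ || X]ltrNr h orbT.
  by rewrite -ltNge => ->.
pose A1 := [set w | X t w < - K]; pose L := [set w | X t w <= K].
have U : (P (A1 `|` ~` L) = P A1 + P (~` L))%E.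
  apply: measureU; first exact: mlt.
    by apply: measurableC; exact: mle.
  apply/seteqP; split => // w /= [h1 /negP]; rewrite -ltNge => h2.
  by move: (lt_trans h2 h1); rewrite ltNge (le_trans _ K0)// oppr_le0.
rewrite -/A1 -/L U probability_setC; last exact: mle.
rewrite /A1 /L cdf cdflt -EFinB -EFinD; congr EFin.
rewrite (_ : (- K - m) / sg = - ((K + m) / sg)); last by rewrite -[RHS]mulNr opprD.
rewrite PhiN; ring.
Unshelve. all: by end_near. Qed.

(** * Monotonicity of [g], the rejection event and its power *)

Lemma powR_lt (R : realType) (t c c' : R) : 1 < t -> (t `^ c < t `^ c') = (c < c').
Proof.
move=> t1; have t0 : 0 < t := lt_trans ltr01 t1.
by rewrite /powR gt_eqF// ltr_expR ltr_pM2r// ln_gt0.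
Qed.

Lemma g_lt (R : realType) (H theta x0 t c c' : R) : 0 < H -> 1 < t -> c < c' ->
  g H theta x0 t c < g H theta x0 t c'.
Proof.
move=> H0 t1 cc'; have t0 : 0 < t := lt_trans ltr01 t1.
have sg0 : 0 < Num.sqrt (v H theta t) by rewrite sqrtr_gt0 v_gt0.
rewrite /g ltrD2r; apply: ltrD; apply: Phi_lt; rewrite ltr_pM2r ?invr_gt0//.
  by rewrite ltrD2r ltr_expR powR_lt.
by rewrite ltrD2r ltr_expR powR_lt.
Qed.

Lemma g_le_mono (R : realType) (H theta x0 t c c' : R) : 0 < H -> 1 < t ->
  (g H theta x0 t c <= g H theta x0 t c') = (c <= c').
Proof.
move=> H0 t1; have [cc'|cc'] := leP c c'.
  by move: cc'; rewrite le_eqVlt => /predU1P[->|/(g_lt theta x0 H0 t1)/ltW//]; rewrite lexx.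
by apply/negbTE; rewrite -ltNge g_lt.
Qed.

(** In units of the standard deviation the shift |x0| E / sqrt V grows and the half-width K / sqrt V
    shrinks. The hypothesis on [E ^- 2 * V] is the squared form of the first claim. *)
Lemma Phi_interval_scale_le (R : realType) (V V' E E' K x0 : R) :
  0 < V -> V <= V' -> 0 < E -> 0 < E' -> E' ^- 2 * V' <= E ^- 2 * V -> 0 <= K ->
  Phi ((K - x0 * E') / Num.sqrt V') + Phi ((K + x0 * E') / Num.sqrt V') <=
  Phi ((K - x0 * E) / Num.sqrt V) + Phi ((K + x0 * E) / Num.sqrt V).
Proof.
move=> V0 VV' E0 E'0 EV K0; have V'0 : 0 < V' := lt_le_trans V0 VV'.
have s1 : 0 < Num.sqrt V by rewrite sqrtr_gt0.
have s2 : 0 < Num.sqrt V' by rewrite sqrtr_gt0.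
rewrite !mulrBl !mulrDl; apply: Phi_sym_interval_le.
- have EE' : E / Num.sqrt V <= E' / Num.sqrt V'.
    rewrite ler_pdivrMr// mulrAC ler_pdivlMr//.
    rewrite -ler_sqr ?nnegrE ?mulr_ge0 ?sqrtr_ge0 ?(ltW E0) ?(ltW E'0)//.
    rewrite !exprMn (sqr_sqrtr (ltW V0)) (sqr_sqrtr (ltW V'0)).
    by move: EV; rewrite ler_pdivlMl ?exprn_gt0// mulrCA ler_pdivrMl ?exprn_gt0.
  rewrite -!mulrA normrM [leRHS]normrM ler_wpM2l//.
  by rewrite !gtr0_norm ?divr_gt0.
- by rewrite divr_ge0 ?sqrtr_ge0.
- by rewrite ler_wpM2l// lef_pV2 ?posrE// ler_wsqrtr.
Qed.

Lemma g_nonincreasing (R : realType) (H theta theta' x0 t c : R) : 0 < H -> 0 < t ->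
  theta <= theta' -> g H theta' x0 t c <= g H theta x0 t c.
Proof.
move=> H0 t0 th; rewrite /g lerD2r.
apply: Phi_interval_scale_le.
- exact: v_gt0.
- exact: v_nondecreasing.
- exact: expR_gt0.
- exact: expR_gt0.
- exact: v_scaled_nonincreasing.
- exact: expR_ge0.
Qed.

Lemma lt_Z (R : realType) (t c x : R) : 1 < t -> 0 < c ->
  (c < Z t x) = (expR (t `^ c) < `|x|).
Proof.
move=> t1 c0; have t0 : 0 < t := lt_trans ltr01 t1.
have lt0 : 0 < ln t by rewrite ln_gt0.
(* Where [logp] truncates, ln |x| <= 1 < t^c and [Z] is 0, so both inequalities fail together. *)
have tc1 : 1 < t `^ c by rewrite -(powRr0 t) powR_lt.
rewrite /Z ltr_pdivlMr// /logp; case: ifPn => [lx|].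
  have x0 : 0 < `|x|.
    rewrite lt_neqAle normr_ge0 andbT; apply/eqP => x0.
    by move: lx; rewrite -x0 ln0// ltr10.
  have lx0 : 0 < ln `|x| := lt_trans ltr01 lx.
  by rewrite -[RHS](ltr_ln _ _) ?posrE ?expR_gt0// expRK -[RHS]ltr_ln ?posrE ?powR_gt0// ln_powR.
rewrite -leNgt => lx; rewrite ltNge mulr_ge0 ?(ltW c0) ?(ltW lt0)//=.
apply/esym/negbTE; rewrite -leNgt.
have [->|x0] := eqVneq `|x| 0; first exact: expR_ge0.
have {}x0 : 0 < `|x| by rewrite lt_neqAle eq_sym x0 normr_ge0.
by rewrite -ler_ln ?posrE ?expR_gt0// expRK (le_trans lx)// ltW.
Qed.

Lemma rejectionE d (T : measurableType d) (R : realType) (H x0 alpha : R)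
    (X : R -> {mfun T >-> R}) (t c : R) : 0 < H -> 1 < t -> critical_level H x0 alpha t c ->
  rejection H x0 alpha X t = [set w | expR (t `^ c) < `|X t w|].
Proof.
move=> H0 t1 [/andP[c0 c1] gc]; rewrite /rejection -gc; apply/seteqP; split => w /=;
  by rewrite g_le_mono// -(lt_Z _ t1 c0) ltNge => /negP.
Qed.

Lemma measurable_rejection d (T : measurableType d) (R : realType) (H x0 alpha : R)
    (X : R -> {mfun T >-> R}) (t c : R) : 0 < H -> 1 < t -> critical_level H x0 alpha t c ->
  measurable (rejection H x0 alpha X t).
Proof.
move=> H0 t1 cc; rewrite (rejectionE X H0 t1 cc).
have mX : measurable_fun setT (fun w => `|X t w|) by exact: measurableT_comp.
have := mX measurableT _ (measurable_itv `]expR (t `^ c), +oo[); rewrite setTI.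
by congr measurable; apply/seteqP; split => w /=; rewrite in_itv/= andbT.
Qed.

Lemma rejection_power d (T : measurableType d) (R : realType) (P : probability T R)
    (H x0 alpha theta : R) (X : R -> {mfun T >-> R}) (t c : R) : 0 < H -> 1 < t ->
  fOU P H x0 theta X -> critical_level H x0 alpha t c ->
  P (rejection H x0 alpha X t) = (1 - g H theta x0 t c)%:E.
Proof.
move=> H0 t1 XfOU cc; rewrite (rejectionE X H0 t1 cc) (fOU_exceedance H0 XfOU)//.
exact: lt_trans t1.
Qed.

(* The critical boundary grows like [t ^ H] only, since under [theta = 0] the variance of
   [X_t] is [t ^ (2 * H)]. *)
Lemma critical_boundary (R : realType) (H x0 alpha q t c : R) : 0 < H -> 0 < t ->
  1 - alpha < 2 * Phi q - 1 -> critical_level H x0 alpha t c ->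
  expR (t `^ c) < `|x0| + q * t `^ H.
Proof.
move=> H0 t0 qa [_ gc]; rewrite ltNge; apply/negP => hK.
have N0 : 0 < t `^ H by rewrite powR_gt0.
have x1 := ler_norm x0; have x2 := ler_norm (- x0); rewrite normrN in x2.
(* With the boundary at least |x0| + q t^H, both arguments of [Phi] under theta = 0 would be at
   least [q], contradicting the choice of [q]. *)
have : 2 * Phi q - 1 <= g H 0 x0 t c.
  have sE : Num.sqrt (t `^ (2 * H)) = t `^ H.
    by rewrite mulrC powRrM powR_mulrn ?(ltW N0)// sqrtr_sqr gtr0_norm.
  rewrite /g v0E// sE mul0r expR0 mulr1 (_ : 2 * Phi q = Phi q + Phi q); last by ring.
  rewrite lerD2r; apply: lerD; apply: Phi_le; rewrite ler_pdivlMr//; lra.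
by rewrite gc; lra.
Qed.

(** The bound depends on [t] through one decaying exponential only: as t^H >= 1 the boundary is at
    most (|x0| + q) t^H, and t^H cancels against the standard deviation. *)
Lemma power_ge (R : realType) (H theta x0 alpha q t c : R) : 0 < H -> 1 < t -> 0 <= theta ->
  0 <= q -> 1 - alpha < 2 * Phi q - 1 -> critical_level H x0 alpha t c ->
  2 - 2 * Phi (2 * (`|x0| + q) * expR (- (theta / 2 * t))) <= 1 - g H theta x0 t c.
Proof.
move=> H0 t1 th0 q0 qa cc; have t0 : 0 < t := lt_trans ltr01 t1.
have Kb := critical_boundary H0 t0 qa cc.
set K := expR (t `^ c) in Kb.
have K0 : 0 <= K := expR_ge0 _.
have N1 : 1 <= t `^ H by rewrite -(powRr0 t) ler_powR// ltW.
have N0 : 0 < t `^ H := lt_le_trans ltr01 N1.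
(* The square root of [v_ge_expR] gives 1 / sqrt 2, weakened here to 1 / 2; this is the origin of
   the factor 2 in the statement. *)
have sv : expR (theta / 2 * t) * t `^ H / 2 <= Num.sqrt (v H theta t).
  have Ege : 0 <= expR (theta / 2 * t) * t `^ H / 2.
    by rewrite divr_ge0// mulr_ge0 ?expR_ge0// ltW.
  rewrite -(ger0_norm Ege) -sqrtr_sqr; apply: ler_wsqrtr.
  apply: le_trans (v_ge_expR H0 th0 t0).
  have -> : t `^ (2 * H) = (t `^ H) ^+ 2 by rewrite mulrC powRrM powR_mulrn// ltW.
  have -> : expR (theta * t) = expR (theta / 2 * t) ^+ 2 by rewrite -expRM_natl; congr expR; field.
  rewrite !exprMn; have := sqr_ge0 (expR (theta / 2 * t)); have := sqr_ge0 (t `^ H) => h1 h2.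
  have := mulr_ge0 h2 h1; lra.
have s0 : 0 < Num.sqrt (v H theta t) by rewrite sqrtr_gt0 v_gt0.
have -> : 1 - g H theta x0 t c = 2 - (Phi ((K - x0 * expR (theta * t)) / Num.sqrt (v H theta t)) +
    Phi ((K + x0 * expR (theta * t)) / Num.sqrt (v H theta t))) by rewrite /g -/K; lra.
move: s0 sv; move: (Num.sqrt _) => sg s0 sv.
set m := x0 * _; rewrite [(K - m) / sg]mulrBl [(K + m) / sg]mulrDl.
(* Acceptance is most likely for a centered variable, so the drifted mean may be replaced by 0. *)
have h1 := @Phi_sym_interval_le R 0 (m / sg) (K / sg) (K / sg).
have Ksg0 : 0 <= K / sg by rewrite divr_ge0// ltW.
rewrite normr0 subr0 addr0 in h1.
have {}h1 := h1 (normr_ge0 _) Ksg0 (lexx _).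
suff h2 : Phi (K / sg) <= Phi (2 * (`|x0| + q) * expR (- (theta / 2 * t))) by lra.
apply: Phi_le; rewrite ler_pdivrMr//.
have e0 := expR_gt0 (theta / 2 * t).
have x00 := normr_ge0 x0.
apply: (@le_trans _ _ ((`|x0| + q) * t `^ H)).
  apply: (le_trans (ltW Kb)); rewrite mulrDl lerD2r.
  by rewrite ler_peMr.
move: e0 sv; rewrite expRN; move: (expR _) (t `^ H) N0 => E N N0 E0 sv.
have q1 : 0 <= `|x0| + q by rewrite addr_ge0.
apply: (@le_trans _ _ ((`|x0| + q) * (2 * (E^-1 * (E * N / 2))))).
  by rewrite (_ : 2 * (E^-1 * (E * N / 2)) = N)//; field; rewrite gt_eqF.
rewrite [leRHS](_ : _ = (`|x0| + q) * (2 * (E^-1 * sg))); last by ring.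
by rewrite ler_wpM2l// ler_wpM2l// ler_wpM2l// invr_ge0 ltW.
Qed.

Lemma fOU_power_cvg d (T : measurableType d) (R : realType) (P : probability T R)
    (H x0 alpha theta t0 : R) (X : R -> {mfun T >-> R}) :
  0 < H -> 0 < alpha -> fOU P H x0 theta X -> threshold_time H x0 alpha t0 -> 0 < theta ->
  P (rejection H x0 alpha X t) @[t --> +oo%R] --> 1%E.
Proof.
move=> H0 a0 XfOU [t01 t0P] th0.
(* Any [q] with Phi(q) > 1 - alpha / 2 will do; it is fixed once, independently of [t]. *)
have [q [q0 qa]] : exists q : R, 0 < q /\ 1 - alpha < 2 * Phi q - 1.
  have a2 : 0 < alpha / 2 by rewrite divr_gt0.
  have /cvgrPdist_lt/(_ _ a2) hq := @Phi_cvgy R.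
  near (+oo%R : set_system R) => q; exists q; split; first by near: q; exact: nbhs_pinfty_gt.
  have : `|1 - Phi q| < alpha / 2 by near: q.
  by rewrite ltr_norml => /andP[h1 h2]; lra.
pose l t : R := 2 - 2 * Phi (2 * (`|x0| + q) * expR (- (theta / 2 * t))).
have lcvg : (l t)%:E @[t --> +oo%R] --> (1 : R)%:E.
  have e1 : expR (- (theta / 2 * t)) @[t --> +oo%R] --> (0 : R).
    apply: (@cvg_comp _ _ _ (fun t : R => theta / 2 * t) (fun y => expR (- y)) _ +oo%R).
      by apply/gt0_cvgMry; [rewrite divr_gt0|exact: cvg_id].
    exact: cvgr_expR.
  have e2 : 2 * (`|x0| + q) * expR (- (theta / 2 * t)) @[t --> +oo%R] --> 2 * (`|x0| + q) * 0.
    by apply: cvgM e1; exact: cvg_cst.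
  have e3 : Phi (2 * (`|x0| + q) * expR (- (theta / 2 * t))) @[t --> +oo%R] -->
      Phi (2 * (`|x0| + q) * 0).
    by apply: (cvg_comp _ (@Phi R) e2); exact: Phi_continuous.
  apply: cvg_EFin; first by near=> t.
  rewrite [X in _ --> X](_ : _ = 2 - 2 * Phi (2 * (`|x0| + q) * 0)); last first.
    by rewrite mulr0 Phi0; field.
  by apply: cvgB; [exact: cvg_cst|apply: cvgM e3; exact: cvg_cst].
apply: (squeeze_cvge _ lcvg (cvg_cst 1%E)).
near=> t.
have t0t : t0 < t by near: t; apply: nbhs_pinfty_gt; exact: num_real.
have t1 : 1 < t := le_lt_trans t01 t0t.
have [c [cc _]] := t0P t t0t.
rewrite probability_le1 ?andbT; last first.
  exact: measurable_rejection cc.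
rewrite (rejection_power H0 t1 XfOU cc) lee_fin.
exact: (power_ge H0 t1 (ltW th0) (ltW q0) qa cc).
Unshelve. all: by end_near. Qed.

Theorem theorem2p7 (R : realType) (H x0 alpha : R)
    (H01 : 0 < H < 1) (alpha01 : 0 < alpha < 1)
    (d : measure_display) (T : measurableType d)
    (P : R -> probability T R) (X : R -> {mfun T >-> R})
    (XfOU : forall theta : R, fOU (P theta) H x0 theta X)
    (t0 : R) (t0P : threshold_time H x0 alpha t0) :
  let rej := rejection H x0 alpha X in
  [/\ forall t : R, t0 < t ->
        unbiased P [set theta | theta <= 0] [set theta | 0 < theta]
          alpha (rej t),
      consistent P [set theta | 0 < theta] rej
    & forall theta1 t c : R, 0 < theta1 -> t0 < t ->
        critical_level H x0 alpha t c ->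
        P theta1 (rej t) = (1 - g H theta1 x0 t c)%:E].
Proof.
move=> rej.
have /andP[H0 _] := H01; have /andP[a0 _] := alpha01; have [t01 t0ex] := t0P.
split.
- move=> t t0t; have t1 : 1 < t := le_lt_trans t01 t0t.
  have [c [cc _]] := t0ex t t0t; have [_ gc] := cc.
  (* At theta = 0 the power is exactly alpha, and monotonicity of [g] in theta gives both
     inequalities. *)
  split=> theta /= th; rewrite (rejection_power H0 t1 (XfOU theta) cc) lee_fin.
    have := g_nonincreasing x0 c H0 (lt_trans ltr01 t1) th.
    by rewrite gc lerBlDr -lerBlDl.
  have := g_nonincreasing x0 c H0 (lt_trans ltr01 t1) (ltW th).
  by rewrite gc lerBrDr -lerBrDl.
- by move=> theta th; exact: fOU_power_cvg H0 a0 (XfOU theta) t0P th.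
- move=> theta1 t c _ t0t cc.
  by rewrite (rejection_power H0 (le_lt_trans t01 t0t) (XfOU theta1) cc).
Qed.
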